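(* Let $\alpha_{1},\alpha_{2},\ldots$ be independent uniform random variables on $[0,1)$, $A_{j}(z)=\int_{0}^{z}2\sin^{2}(\pi(s+\alpha_{j}))\,ds$, $S_{n}=A_{n}\circ\cdots\circ A_{1}$ ($S_0=\mathrm{id}$), $\mathcal{F}_{n}=\sigma(\alpha_{1},\ldots,\alpha_{n})$, and $z_{n}=S_{n}(z)$ for $z\in[0,1]$. Then: (i) for every $z$, the rank orbit $z_{n}$ converges almost surely to a limit $z_{\infty}\in\{0,1\}$ with $\mathbb{P}(z_{\infty}=1)=z$, and $$\operatorname{Var}\big(z_{n+1}\,\big|\,\mathcal{F}_{n}\big)=\frac{\sin^{2}(\pi z_{n})}{2\pi^{2}},\qquad\sum_{n\ge0}\mathbb{E}\big[\sin^{2}(\pi z_{n})\big]=2\pi^{2}\,z(1-z)$$ hold exactly; (ii) almost surely there is a random threshold $\tau$ such that $S_{n}(z)\to0$ for all $z<\tau$ and $S_{n}(z)\to1$ for all $z>\tau$, and $\tau$ is uniformly distributed on $(0,1)$; (iii) for every $f\in\mathcal{D}_{+}$ with distribution function $F$ and quantile function $Q$, the random densities $f_{n}=S_{n}'(F)\,f$ satisfy, almost surely, $f_{n}\to\delta_{Q(\tau)}$ weakly (weak-$*$), and $Q(\tau)\sim f$, i.e. $Q(\tau)$ has density $f$; (iv) for every $z\in(0,1)$, almost surely $\tfrac1n\log\min(z_{n},1-z_{n})\to-\log2$.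
   Context: $\mathcal{D}_{+}$ is the set of probability densities on $\mathbb{R}$ that are continuous and strictly positive on an open interval and vanish outside it; $Q=F^{-1}$ on $(0,1)$. The density $f_{n}$ is the result of successively applying the operators $\rho_{w_{\alpha_{j}}}[g]=w_{\alpha_{j}}(G)\,g$ ($G$ the distribution function of $g$), $j=1,\ldots,n$, to $f$, where $w_{\alpha}(z)=2\sin^{2}(\pi(z+\alpha))$. *)

(* Defs.v *)
From HB Require Import structures.
From mathcomp Require Import all_boot all_order all_algebra.
From mathcomp Require Import all_classical all_reals all_analysis.

Set Implicit Arguments.
Unset Strict Implicit.
Unset Printing Implicit Defensive.

Import Order.TTheory GRing.Theory Num.Theory.
Import numFieldNormedType.Exports.

Local Open Scope classical_set_scope.
Local Open Scope ring_scope.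

Section rank_maps.
Variable R : realType.
Local Notation mu := (@lebesgue_measure R).

Definition sin2_weight (a s : R) : R := 2 * sin (pi * (s + a)) ^+ 2.

(* The integral is over the set `[0, z], so this is the intended primitive
   only for z >= 0; only arguments in `[0, 1] are relevant. *)
Definition rank_map (a z : R) : R :=
  \int[mu]_(s in `[0, z]) sin2_weight a s.

(* The parameter sequence is indexed from 0: a 0 is the parameter of the first
   map applied. *)
Fixpoint rank_orbit (a : nat -> R) (n : nat) (z : R) : R :=
  if n is m.+1 then rank_map (a m) (rank_orbit a m z) else z.

Definition distfun (g : R -> R) (x : R) : R := \int[mu]_(t in `]-oo, x]) g t.

Definition reweight (w : R -> R) (g : R -> R) : R -> R :=
  fun x => w (distfun g x) * g x.

Fixpoint density_orbit (a : nat -> R) (f : R -> R) (n : nat) : R -> R :=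
  if n is m.+1 then reweight (sin2_weight (a m)) (density_orbit a f m) else f.

Definition prob_density (f : R -> R) : Prop :=
  [/\ measurable_fun setT f, (forall x, 0 <= f x) &
      (\int[mu]_x (f x)%:E = 1)%E].

(* The open interval I may be unbounded. *)
Definition Dplus (f : R -> R) : Prop :=
  prob_density f /\
  exists I : set R, [/\ open I, is_interval I,
    (forall x, I x -> {for x, continuous f}),
    (forall x, I x -> 0 < f x) & (forall x, ~ I x -> f x = 0)].

(* For f in Dplus, distfun f is a bijection from the interval where f is
   positive onto `]0, 1[; this is its inverse there, and 0 elsewhere. *)
Definition quantile (f : R -> R) : R -> R :=
  'pinv_(fun=> 0) [set x | 0 < f x] (distfun f).

Definition cvg_weakly_to_dirac (g : nat -> R -> R) (c : R) : Prop :=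
  forall phi : R -> R, continuous phi -> bounded_fun phi ->
    (\int[mu]_x (phi x * g n x)%:E)%E @[n --> \oo] --> (phi c)%:E.

End rank_maps.

Section probability_notions.
Context d (T : measurableType d) (R : realType) (P : probability T R).

Definition mutually_independent (X : nat -> T -> R) : Prop :=
  forall (s : seq nat) (B : nat -> set R), uniq s ->
    (forall i, measurable (B i)) ->
    (P (\bigcap_(i in [set` s]) (X i @^-1` B i)) =
     \prod_(i <- s) P (X i @^-1` B i))%E.

(* The laws uniform on the open, half-open and closed unit interval coincide. *)
Definition uniform01 (X : {RV P >-> R}) : Prop :=
  forall B : set R, measurable B ->
    distribution P X B = uniform_prob (@ltr01 R) B.

Definition has_density (X : T -> R) (f : R -> R) : Prop :=
  measurable_fun setT X /\
  forall B : set R, measurable B ->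
    (P (X @^-1` B) = \int[lebesgue_measure]_(x in B) (f x)%:E)%E.

(* Y is a version of E[X | G]. *)
Definition is_cond_exp (G : set (set T)) (X Y : T -> R) : Prop :=
  [/\ P.-integrable setT (EFin \o X), P.-integrable setT (EFin \o Y),
      (forall B : set R, measurable B -> G (Y @^-1` B)) &
      (forall A, G A ->
         \int[P]_(w in A) (Y w)%:E = \int[P]_(w in A) (X w)%:E)%E].

(* V is a version of Var(X | G). *)
Definition is_cond_var (G : set (set T)) (X V : T -> R) : Prop :=
  exists2 m : T -> R, is_cond_exp G X m &
    is_cond_exp G (fun w => (X w - m w) ^+ 2) V.

(* The sigma-algebra generated by the first n variables. *)
Definition natural_filtration (X : nat -> T -> R) (n : nat) : set (set T) :=
  g_sigma_preimage (fun i : 'I_n => X i).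

End probability_notions.

Arguments uniform01 {d T R} P X.

(* Main.v *)
Require Import Defs.
From HB Require Import structures.
From mathcomp Require Import all_boot all_order all_algebra.
From mathcomp Require Import ring lra.
From mathcomp Require Import all_classical all_reals all_analysis.
From mathcomp Require Import measurable_realfun.

(** Integrating the weight gives the rank map in closed form,
      A_a(z) = z - sin (pi z) / pi * cos (2 pi a + pi z).
    For uniform a the increment has mean 0 and variance
    sin^2 (pi z) / (2 pi^2). Since alpha_n is independent of the first n
    parameters, it can be integrated out with the past held fixed
    ([filtration_freezing]); hence z_n is a martingale in [0, 1] with the
    announced conditional variance ([orbit_cond_var]).

    The second moments telescope: the sum of the E [sin^2 (pi z_n)] over n < N
    is 2 pi^2 (E [z_N^2] - z^2). It is bounded, so sin (pi z_n) tends to 0 almost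
    surely. The step from z_n is at most sin (pi z_n) / pi, so eventually the
    orbit cannot cross from one end of [0, 1] to the other, and it converges to
    0 or to 1 ([rank_orbit_dichotomy]). Dominated convergence keeps the mean, so
    the limit is 1 with probability z, and E [z_N^2] tends to z, which makes the
    sum exactly 2 pi^2 z (1 - z).

    Each S_n is nondecreasing, so the limits from rational starting points
    determine all others: tau is the supremum of the rationals whose orbit
    tends to 0 ([threshold_separates]). The event {tau < t} agrees with the event
    that the orbit of t tends to 1 up to an arbitrarily small error, so tau is
    uniform.

    For a density g with distribution function G, the image of g dx under G is
    Lebesgue measure ([distfun_pushforward]). Therefore reweighting g composes G
    with the rank map, and f_n has distribution function S_n o F. It tends to 0
    where F < tau and to 1 where F > tau, which is weak convergence to the point
    mass at Q(tau). Moreover Q(tau) < x means tau < F(x), so Q(tau) has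
    distribution function F.

    For the rate, a step near 0 multiplies z by 1 - k cos (2 pi (a + z / 2)) with
    k = sin (pi z) / (pi z), and
      1 - k cos t = (1 + s) / 2 * |1 - r e^(i t)|^2
    with s = sqrt (1 - k^2) and r = k / (1 + s) ([cosine_factorE]). Over a uniform
    angle log |1 - r e^(i t)|^2 has mean zero and a second moment bounded
    uniformly in r < 1. Both facts come from |1 - w|^2 |1 + w|^2 = |1 - w^2|^2,
    which relates the radii r and r^2 ([Rintegral_log_kernel],
    [Rintegral_log_kernel_sqr]). Along the orbit these logarithms therefore
    average to 0 ([orbit_log_kernel_law], through the strong law
    [strong_law_nonneg]). If z_n tends to 0, then s tends to 0, and what remains
    is the factor 1/2 at each step ([log_decay]). The reflection
    1 - A_a(z) = A_(-a)(1 - z) handles the limit 1. *)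

Set Implicit Arguments.
Unset Strict Implicit.
Unset Printing Implicit Defensive.

Import Order.TTheory GRing.Theory Num.Theory.
Import numFieldNormedType.Exports.

Local Open Scope classical_set_scope.
Local Open Scope ring_scope.

(** * The rank map in closed form *)

Section rank_step.
Variable R : realType.

(** The primitive of the weight that vanishes at 0; it agrees with the integral
    for nonnegative arguments, and unlike it is smooth on the whole line. *)
Definition rank_step (a z : R) : R :=
  z - sin (pi * z) / pi * cos (2 * pi * a + pi * z).

Lemma is_derive_rank_step (a z : R) :
  is_derive z 1 (rank_step a) (sin2_weight a z).
Proof.
pose s (z : R) := pi * z.
pose u (z : R) := 2 * pi * a + pi * z.
have ds : is_derive z 1 s pi.
  by apply: is_derive_eq; rewrite /GRing.scale /= ?mulr1 ?add0r ?mul1r ?mulr0 ?addr0.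
have du : is_derive z 1 u pi.
  by apply: is_derive_eq; rewrite /GRing.scale /= ?mulr1 ?add0r ?mul1r ?mulr0 ?addr0 ?add0r.
have -> : rank_step a = (fun z => z - (sin \o s) z * pi^-1 * (cos \o u) z) by [].
apply: is_derive_eq.
rewrite /= /GRing.scale /= /sin2_weight.
have p0 : pi != 0 :> R by rewrite gt_eqF// pi_gt0.
have -> : pi * (z + a) = (s z + u z) / 2 by rewrite /s/u; field.
have -> : sin ((s z + u z) / 2) ^+ 2 = (1 - cos (s z + u z)) / 2.
  have {2}-> : s z + u z = ((s z + u z) / 2) *+ 2 by rewrite -mulr_natr; field.
  by rewrite cos_mulr2n cos2sin2 -mulr_natr; field.
rewrite [cos (s z + u z)]cosD; clear ds du; move: (sin _) (sin _) (cos _) (cos _) => A B C D.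
by clear s u; move: pi p0 => p p0; field.
Qed.

Lemma continuous_rank_step (a : R) : continuous (rank_step a).
Proof.
move=> z; apply/differentiable_continuous/derivable1_diffP.
exact: (@ex_derive _ _ _ _ _ _ _ (is_derive_rank_step a z)).
Qed.

Lemma continuous_sin2_weight (a : R) : continuous (sin2_weight a).
Proof.
move=> s; rewrite /sin2_weight.
apply: cvgM; first exact: cvg_cst.
have h : {for s, continuous (fun s => sin (pi * (s + a)))}.
  apply: continuous_comp; last exact: continuous_sin.
  apply: cvgM; first exact: cvg_cst.
  by apply: cvgD; [exact: cvg_id|exact: cvg_cst].
exact: (cvgM h h).
Qed.

Lemma rank_mapE (a z : R) : 0 <= z -> rank_map a z = rank_step a z.
Proof.
rewrite le_eqVlt => /predU1P[<-|z0]; rewrite /rank_map.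
  by rewrite set_itv1 Rintegral_set1 /rank_step mulr0 sin0 !mul0r subr0.
rewrite /Rintegral (@continuous_FTC2 _ _ (rank_step a)) //=.
- by rewrite {2}/rank_step mulr0 sin0 !mul0r !subr0.
- exact/continuous_subspaceT/continuous_sin2_weight.
- split.
  + by move=> x _; exact: (@ex_derive _ _ _ _ _ _ _ (is_derive_rank_step a x)).
  + exact/cvg_at_right_filter/continuous_rank_step.
  + exact/cvg_at_left_filter/continuous_rank_step.
- move=> x _; rewrite derive1E.
  exact: (@derive_val _ _ _ _ _ _ _ (is_derive_rank_step a x)).
Qed.

Lemma sin2_weight_ge0 (a s : R) : 0 <= sin2_weight a s.
Proof. by rewrite mulr_ge0 ?sqr_ge0. Qed.

Lemma rank_step_nd (a x y : R) : x <= y -> rank_step a x <= rank_step a y.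
Proof.
rewrite le_eqVlt => /predU1P[->//|xy].
have [||c _ E] := @MVT _ (rank_step a) (sin2_weight a) x y xy.
- by move=> z _; exact: is_derive_rank_step.
- exact/continuous_subspaceT/continuous_rank_step.
- by rewrite -subr_ge0 E mulr_ge0 ?sin2_weight_ge0// subr_ge0 ltW.
Qed.

Lemma rank_step0 (a : R) : rank_step a 0 = 0.
Proof. by rewrite /rank_step mulr0 sin0 !mul0r subr0. Qed.

Lemma rank_step1 (a : R) : rank_step a 1 = 1.
Proof. by rewrite /rank_step mulr1 sinpi !mul0r subr0. Qed.

Lemma rank_step_itv (a z : R) : 0 <= z <= 1 -> 0 <= rank_step a z <= 1.
Proof.
move=> /andP[z0 z1]; apply/andP; split.
  by rewrite -(rank_step0 a) rank_step_nd.
by rewrite -[leRHS](rank_step1 a) rank_step_nd.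
Qed.

Lemma pi_neq0 : pi != 0 :> R. Proof. by rewrite gt_eqF// pi_gt0. Qed.

(** Mean value theorem on [0, x]: sin x = x cos c with c < x, and cosine
    decreases on the first quadrant. *)
Lemma sin_geM (x : R) : 0 <= x <= pi / 2 -> x * cos x <= sin x.
Proof.
move=> /andP[]; rewrite le_eqVlt => /predU1P[<-|x0 xp]; first by rewrite mul0r sin0.
have [|c cI E] := @MVT _ sin cos 0 x x0.
- exact/continuous_subspaceT/continuous_sin.
move: cI E; rewrite in_itv/= sin0 !subr0 => /andP[c0 cx] ->.
rewrite mulrC ler_wpM2r ?(ltW x0)//; have pp := @pi_gt0 R.
by rewrite ltW// ltr_cos// in_itv/=; lra.
Qed.

Lemma sin_le_id (x : R) : 0 <= x -> sin x <= x.
Proof.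
rewrite le_eqVlt => /predU1P[<-|x0]; first by rewrite sin0.
have [|c _ E] := @MVT _ sin cos 0 x x0.
- exact/continuous_subspaceT/continuous_sin.
by move: E; rewrite sin0 !subr0 => ->; rewrite ler_piMl ?cos_le1// ltW.
Qed.

Lemma sin_half (x : R) : sin x = 2 * (cos (x / 2) * sin (x / 2)).
Proof.
have {1}-> : x = (x / 2) *+ 2 by rewrite -mulr_natr; field.
by rewrite sin_mulr2n -mulr_natl.
Qed.

Lemma sin_lt_id (x : R) : 0 < x <= pi -> sin x < x.
Proof.
move=> /andP[x0 xp]; rewrite sin_half.
have pp := @pi_gt0 R.
have h : sin (x / 2) <= x / 2 by apply: sin_le_id; lra.
have c1 : cos (x / 2) < 1.
  by rewrite -[ltRHS]cos0 ltr_cos// ?in_itv/=; lra.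
have s0 : 0 < sin (x / 2) by apply: sin_gt0_pi; lra.
have : cos (x / 2) * sin (x / 2) < sin (x / 2) by rewrite gtr_pMl.
lra.
Qed.

(** By duplication and [sin_geM] at x/2, sin x >= x cos^2 (x/2), and
    cos^2 (x/2) = (1 + cos x)/2 >= 1/2 on the first quadrant. *)
Lemma sin_ge_half (x : R) : 0 <= x <= pi / 2 -> x / 2 <= sin x.
Proof.
move=> /andP[x0 xp]; rewrite sin_half.
have pp := @pi_gt0 R.
have h : x / 2 * cos (x / 2) <= sin (x / 2) by apply: sin_geM; lra.
have c0 : 0 <= cos (x / 2) by apply: cos_ge0_pihalf; lra.
have h2 : x / 2 * cos (x / 2) ^+ 2 <= cos (x / 2) * sin (x / 2).
  by rewrite expr2 mulrCA; apply: ler_wpM2l; rewrite // mulrC.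
have c2 : cos x = cos (x / 2) ^+ 2 *+ 2 - 1.
  by rewrite -cos_mulr2n; congr cos; rewrite -mulr_natr; field.
have cx : 0 <= cos x by apply: cos_ge0_pihalf; lra.
have : 1 / 2 <= cos (x / 2) ^+ 2 by rewrite -mulr_natr in c2; lra.
move: (cos (x / 2) ^+ 2) (cos (x / 2) * sin (x / 2)) h2 => C S h2 hC.
have : x / 2 * (1 / 2) <= x / 2 * C by apply: ler_wpM2l; lra.
lra.
Qed.

Lemma sin_piB (x : R) : sin (pi * (1 - x)) = sin (pi * x).
Proof. by rewrite mulrBr mulr1 sinB sinpi cospi mul0r sub0r mulN1r opprK. Qed.

(** A small value of sin (pi z) forces z to be close to 0 or to 1; this turns
    summability of the conditional variances into convergence of the orbit. *)
Lemma sin_pi_ge (z : R) : 0 <= z <= 1 -> z * (1 - z) <= sin (pi * z).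
Proof.
wlog z2 : z / z <= 1 / 2.
  move=> H z01; have [z2|z2] := leP z (1/2); first exact: H.
  rewrite -sin_piB; have -> : z * (1 - z) = (1 - z) * (1 - (1 - z)) by ring.
  by apply: H; lra.
move=> /andP[z0 z1]; have pp := @pi_ge2 R.
have : pi * z / 2 <= sin (pi * z).
  apply: sin_ge_half; rewrite mulr_ge0 ?pi_ge0//=.
  by rewrite ler_wpM2l ?pi_ge0//; lra.
apply: le_trans; apply: (@le_trans _ _ (2 * z / 2)); first by nra.
by rewrite ler_wpM2r// ler_wpM2r.
Qed.

Lemma sin_pi_ge0 (z : R) : 0 <= z <= 1 -> 0 <= sin (pi * z).
Proof. by move=> z01; apply: le_trans (sin_pi_ge z01); nra. Qed.

Lemma rank_step_gt0 (a z : R) : 0 < z <= 1 -> 0 < rank_step a z.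
Proof.
move=> /andP[z0 z1]; have pp := @pi_gt0 R.
have s0 : 0 <= sin (pi * z) by apply: sin_pi_ge0; lra.
have sz : sin (pi * z) / pi < z.
  by rewrite ltr_pdivrMr// [ltRHS]mulrC; apply: sin_lt_id; rewrite mulr_gt0//= ler_piMr// ltW.
rewrite /rank_step subr_gt0; apply: le_lt_trans sz.
by rewrite ler_piMr ?cos_le1// divr_ge0// ltW.
Qed.

(** Reflection z |-> 1 - z exchanges the two fixed points, so that facts near 1
    follow from facts near 0. *)
Lemma rank_step1B (a z : R) : 1 - rank_step a z = rank_step (- a) (1 - z).
Proof.
rewrite /rank_step sin_piB.
have -> : cos (2 * pi * - a + pi * (1 - z)) = - cos (2 * pi * a + pi * z).
  rewrite -[LHS]cosN -cosDpi -cosD2pi; congr cos.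
  by rewrite -mulr_natr; ring.
by rewrite mulrN; ring.
Qed.

Lemma rank_step_lt1 (a z : R) : 0 <= z < 1 -> rank_step a z < 1.
Proof. by move=> z01; rewrite -subr_gt0 rank_step1B rank_step_gt0//; lra. Qed.

(** The oscillating factor is a cosine, so the step is at most the amplitude
    sin (pi z) / pi, which vanishes at both ends. *)
Lemma rank_step_dist (a z : R) : 0 <= z <= 1 ->
  `|rank_step a z - z| <= sin (pi * z) / pi.
Proof.
move=> z01; rewrite /rank_step addrAC subrr sub0r normrN normrM.
have s0 : 0 <= sin (pi * z) / pi by rewrite divr_ge0 ?pi_ge0 ?sin_pi_ge0.
by rewrite ger0_norm// ler_piMr// cos_max.
Qed.

End rank_step.

(** * Freezing the past *)
Section independence.
Local Open Scope ereal_scope.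
Context d (T : measurableType d) (R : realType) (P : probability T R).
Variable X : nat -> {RV P >-> R}.
Local Notation F n := (natural_filtration (fun j w => X j w) n).

(** A pi-system generating the natural filtration, on which independence is
    the product rule of the definition. *)
Definition cylinder (n : nat) : set (set T) :=
  [set A | exists2 B : nat -> set R, (forall i, measurable (B i)) &
    A = \bigcap_(i in [set` iota 0 n]) (X i @^-1` B i)].

Lemma measurable_preimage_RV (i : nat) (B : set R) :
  measurable B -> measurable (X i @^-1` B).
Proof. by move=> mB; rewrite -[_ @^-1` _]setTI; exact: measurable_funPT. Qed.

Lemma cylinder_measurable n : cylinder n `<=` measurable.
Proof.
move=> _ [B mB ->]; apply: fin_bigcap_measurable => // i _.
exact: measurable_preimage_RV.
Qed.

Lemma cylinderI n : setI_closed (cylinder n).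
Proof.
move=> _ _ [B mB ->] [C mC ->]; exists (fun i => B i `&` C i) => [i|].
  exact: measurableI.
by rewrite -bigcapI.
Qed.

Lemma cylinderT n : cylinder n setT.
Proof.
by exists (fun=> setT) => //; rewrite bigcapT.
Qed.

Lemma filtration_cylinder n : F n `<=` <<s cylinder n>>.
Proof.
apply: sub_sigma_algebra2.
elim/big_ind: _ => [//|G H GC HC A [/GC|/HC]//|i _ _ [B mB <-]].
exists (fun j => if j == i :> nat then B else setT) => [j|]; first by case: ifP.
apply/seteqP; split=> [w [_ Bw] j _|w Aw].
  by rewrite /preimage /=; case: eqP => // ->.
by split=> //; have := Aw i; rewrite /= eqxx mem_iota/= add0n ltn_ord; exact.
Qed.

Lemma filtration_measurable n A : F n A -> measurable A.
Proof.
move=> /filtration_cylinder; apply: (smallest_sub _ (@cylinder_measurable n)).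
exact: sigma_algebra_measurable.
Qed.

Hypothesis Xind : mutually_independent P (fun j w => X j w).

(** Both sides are finite measures in A that agree on cylinders, where the
    equality compares the product rules for n and for n+1 indices. *)
Lemma filtration_indep n A B : F n A -> measurable B ->
  P (A `&` X n @^-1` B) = P A * P (X n @^-1` B).
Proof.
move=> /filtration_cylinder FA mB.
have mD := measurable_preimage_RV n mB.
set D := X n @^-1` B in mD *.
have PD0 : (0 <= fine (P D))%R by rewrite fine_ge0.
have PDE : P D = (fine (P D))%:E by rewrite fineK// fin_num_measure.
rewrite muleC PDE.
pose r : {nonneg R} := NngNum PD0.
apply: (@g_sigma_algebra_measure_unique _ _ _ (cylinder n) _ (fun=> setT) _ _
  (mrestr P mD) (mscale r P)) FA => //=.
- exact: cylinder_measurable.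
- by move=> _; exact: cylinderT.
- by rewrite bigcup_const.
- exact: cylinderI.
- move=> _ [C mC ->]; rewrite /mrestr /mscale /= -PDE.
  rewrite (Xind (iota_uniq 0 n) mC).
  pose C' i := if i == n then B else C i.
  have mC' i : measurable (C' i) by rewrite /C'; case: ifP.
  have := Xind (iota_uniq 0 n.+1) mC'.
  rewrite -(addn1 n) iotaD /= big_cat /= big_seq1 add0n {3}/C' eqxx muleC.
  under eq_big_seq => i.
    rewrite mem_iota /= add0n => ilt; rewrite /C' lt_eqF//.
    over.
  move=> <-; congr (P _); apply/seteqP; split => w /=.
    move=> [Aw Dw] i /=; rewrite mem_cat mem_seq1 /C'.
    by case: eqP => [->//|_]; rewrite orbF => /Aw.
  move=> Aw; split=> [i /= iin|].
    have := Aw i; rewrite /= mem_cat iin /C'; case: eqP => [ei|_]; last exact.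
    by move: iin; rewrite ei mem_iota add0n ltnn.
  by have := Aw n; rewrite /= mem_cat mem_seq1 eqxx orbT /C' eqxx; exact.
- move=> _; rewrite /mrestr setTI.
  by rewrite (le_lt_trans (probability_le1 P mD))// ltry.
Qed.

Hypothesis Xunif : forall j, uniform01 P (X j).

(** Z and the n-th variable have a product law, since Z depends on the first n
    variables only; Tonelli integrates out the uniform one. *)
Lemma filtration_freezing n d2 (T2 : measurableType d2) (Z : T -> T2)
    (phi : T2 * R -> \bar R) :
  (forall C, measurable C -> F n (Z @^-1` C)) ->
  measurable_fun setT phi -> (forall x, 0 <= phi x) ->
  \int[P]_w phi (Z w, X n w) =
  \int[P]_w \int[lebesgue_measure]_(u in `[0%R, 1%R]) phi (Z w, u).
Proof.
move=> FZ mphi phi0.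
have mZ : measurable_fun setT Z.
  by move=> _ C mC; rewrite setTI; exact: (filtration_measurable (FZ _ mC)).
have mW : measurable_fun setT (fun w => (Z w, X n w)) by exact: measurable_fun_pair.
pose Zp : {mfun T >-> T2} := HB.pack Z (isMeasurableFun.Build _ _ _ _ _ mZ).
pose Wp : {mfun T >-> (T2 * R)%type} :=
  HB.pack (fun w => (Z w, X n w)) (isMeasurableFun.Build _ _ _ _ _ mW).
transitivity (\int[distribution P Wp]_x phi x).
  by rewrite ge0_integral_pushforward.
transitivity (\int[distribution P Zp \x distribution P (X n)]_x phi x).
  apply: eq_measure_integral => A mA _; apply/esym.
  apply: product_measure_unique => // C B mC mB.
  rewrite /distribution /pushforward /=.
  by rewrite -filtration_indep//; exact: FZ.
rewrite fubini_tonelli1// ge0_integral_pushforward//; last 2 first.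
  exact: measurable_fun_fubini_tonelli_F.
  by move=> z _; exact: integral_ge0.
rewrite preimage_setT; apply: eq_integral => w _.
have mphiw : measurable_fun setT (fun u : R => phi (Z w, u)).
  exact: measurableT_comp.
rewrite [LHS]ge0_integral_pushforward// preimage_setT.
(* The uniform law lives on the generated sigma-algebra of the line, which is
   convertible to the one carried by the real type; the variable is repackaged
   with that codomain. *)
pose XG : T -> measurableTypeR R := X n.
have mXG : measurable_fun setT XG by exact: (measurable_funPT (X n)).
pose XGp : {mfun T >-> measurableTypeR R} :=
  HB.pack XG (isMeasurableFun.Build _ _ _ _ _ mXG).
pose phiw : measurableTypeR R -> \bar R := fun u => phi (Z w, u).
transitivity (\int[distribution P XGp]_u phiw u).
  by rewrite [RHS]ge0_integral_pushforward// => y _; exact: phi0.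
transitivity (\int[uniform_prob (@ltr01 R)]_u phiw u).
  by apply: eq_measure_integral => B mB _; exact: (Xunif n mB).
have := @integral_uniform R 0 1 ltr01 phiw mphiw (fun u => phi0 (Z w, u)).
by rewrite subr0 invr1 mul1e.
Qed.

End independence.

(** * Maps measurable for the natural filtration *)
Section filtration_measurability.
Context d (T : measurableType d) (R : realType) (P : probability T R).
Variable X : nat -> {RV P >-> R}.

Definition filtration_meas (n : nat) d2 (T2 : measurableType d2) (Z : T -> T2) :=
  forall C, measurable C ->
    natural_filtration (fun j w => X j w) n (Z @^-1` C).

Local Notation G n := (\big[setU/set0]_(i < n)
  preimage_set_system setT (fun w => X i w) measurable).

(** Rephrasing as measurability for the generated sigma-algebra gives access to
    the closure properties of measurable functions. *)
Lemma filtration_measP n d2 (T2 : measurableType d2) (Z : T -> T2) :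
  filtration_meas n Z <->
  measurable_fun setT (Z : g_sigma_algebraType (G n) -> T2).
Proof.
split=> [FZ _ C mC|mZ C mC]; first by rewrite setTI; exact: FZ.
by have := mZ measurableT C mC; rewrite setTI.
Qed.

Lemma filtration_meas_comp n d2 (T2 : measurableType d2) d3
    (T3 : measurableType d3) (Z : T -> T2) (f : T2 -> T3) :
  filtration_meas n Z -> measurable_fun setT f -> filtration_meas n (f \o Z).
Proof.
by move=> FZ mf C mC; rewrite comp_preimage; apply: FZ; rewrite -[_ @^-1` _]setTI; exact: mf.
Qed.

Lemma filtration_meas_pair n d2 (T2 : measurableType d2) d3
    (T3 : measurableType d3) (Z : T -> T2) (Y : T -> T3) :
  filtration_meas n Z -> filtration_meas n Y ->
  filtration_meas n (fun w => (Z w, Y w)).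
Proof.
by move=> /filtration_measP mZ /filtration_measP mY;
  apply/filtration_measP; exact: measurable_fun_pair.
Qed.

Lemma filtration_meas_cst n d2 (T2 : measurableType d2) (c : T2) :
  filtration_meas n (fun=> c).
Proof. by apply/filtration_measP; exact: measurable_cst. Qed.

Lemma filtration_subS n : natural_filtration (fun j w => X j w) n `<=`
  natural_filtration (fun j w => X j w) n.+1.
Proof. by apply: sub_sigma_algebra2; rewrite big_ord_recr /=; exact: subsetUl. Qed.

Lemma filtration_measS n d2 (T2 : measurableType d2) (Z : T -> T2) :
  filtration_meas n Z -> filtration_meas n.+1 Z.
Proof. by move=> FZ C mC; apply: filtration_subS; exact: FZ. Qed.

Lemma filtration_meas_RV n : filtration_meas n.+1 (fun w => X n w).
Proof.
move=> C mC; apply: sub_sigma_algebra; rewrite big_ord_recr /=; right.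
by exists C => //; rewrite setTI.
Qed.

Lemma filtration_meas_indic n (A : set T) :
  natural_filtration (fun j w => X j w) n A -> filtration_meas n (\1_A : T -> R).
Proof.
by move=> FA; apply/filtration_measP; exact: measurable_indic.
Qed.

Lemma filtration_meas_fun n d2 (T2 : measurableType d2) (Z : T -> T2) :
  filtration_meas n Z -> measurable_fun setT Z.
Proof.
by move=> FZ _ C mC; rewrite setTI; exact: (filtration_measurable (FZ _ mC)).
Qed.

Hypothesis Xind : mutually_independent P (fun j w => X j w).
Hypothesis Xunif : forall j, uniform01 P (X j).
Local Open Scope ereal_scope.

(** The indicator of an event of the past may be adjoined to the frozen
    variable; this is the form in which conditional expectations are tested. *)
Lemma filtration_freezing_set n d2 (T2 : measurableType d2) (Z : T -> T2)
    (A : set T) (phi : T2 * R -> \bar R) :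
  natural_filtration (fun j w => X j w) n A -> filtration_meas n Z ->
  measurable_fun setT phi -> (forall x, 0 <= phi x) ->
  \int[P]_(w in A) phi (Z w, X n w) =
  \int[P]_(w in A) \int[lebesgue_measure]_(u in `[0%R, 1%R]) phi (Z w, u).
Proof.
move=> FA FZ mphi phi0.
pose psi (x : R * T2 * R) := `|x.1.1|%:E * phi (x.1.2, x.2).
have mpsi : measurable_fun setT psi.
  apply: emeasurable_funM.
    apply/measurable_EFinP; apply: measurableT_comp => //.
    by apply: measurableT_comp => //; exact: measurable_fst.
  apply: measurableT_comp => //; apply: measurable_fun_pair => //.
  by apply: measurableT_comp => //; exact: measurable_snd.
have psi0 x : 0 <= psi x by rewrite mule_ge0.
have FW := filtration_meas_pair (filtration_meas_indic FA) FZ.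
have E := filtration_freezing Xind Xunif FW mpsi psi0.
rewrite [LHS]integral_mkcond [RHS]integral_mkcond.
transitivity (\int[P]_w psi (\1_A w, Z w, X n w)).
  apply: eq_integral => w _; rewrite /psi /= patchE indicE.
  by case: ifPn => _; rewrite ?normr1 ?mul1e ?normr0 ?mul0e.
rewrite E; apply: eq_integral => w _; rewrite /psi /= patchE indicE.
case: ifPn => _; last first.
  by rewrite normr0; under eq_integral do rewrite mul0e; rewrite integral0.
by rewrite normr1; under eq_integral do rewrite mul1e.
Qed.

End filtration_measurability.

(** * Integrals over segments and periods *)
Section segment_integrals.
Variable R : realType.
Local Notation mu := (@lebesgue_measure R).

Lemma continuous_integrable_itv (h : R -> R) (a b : R) : continuous h ->
  mu.-integrable `[a, b] (EFin \o h).
Proof.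
move=> ch; apply: continuous_compact_integrable; first exact: segment_compact.
exact: continuous_subspaceT.
Qed.

Lemma Rintegral_itv_split (h : R -> R) (a b c : R) : continuous h ->
  a <= b -> b <= c ->
  \int[mu]_(x in `[a, c]) h x =
  \int[mu]_(x in `[a, b]) h x + \int[mu]_(x in `[b, c]) h x.
Proof.
move=> ch ab bc; have iac := @continuous_integrable_itv h a c ch.
have := Rintegral_itvB (x := b) iac; rewrite !bnd_simp => /(_ ab bc).
rewrite Rintegral_itv_obnd_cbnd; last first.
  apply: integrableS (@continuous_integrable_itv h b c ch) => //.
  exact: subset_itv_oc_cc.
by move=> <-; rewrite addrC subrK.
Qed.

Lemma Rintegral_itv_affine (h : R -> R) (k c a b : R) : continuous h ->
  0 < k -> a <= b ->
  \int[mu]_(x in `[k * a + c, k * b + c]) h x =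
  k * \int[mu]_(x in `[a, b]) h (k * x + c).
Proof.
move=> ch k0 ab; pose F (x : R) := k * x + c.
have dF (x : R) : is_derive x 1 F k.
  by apply: is_derive_eq; rewrite /GRing.scale /= ?mulr1 ?add0r ?mul1r ?mulr0 ?addr0.
have cF : continuous F.
  move=> x; apply/differentiable_continuous/derivable1_diffP.
  exact: (@ex_derive _ _ _ _ _ _ _ (dF x)).
have F'E : derive1 F = cst k.
  apply/funext => x; rewrite derive1E.
  exact: (@derive_val _ _ _ _ _ _ _ (dF x)).
rewrite -RintegralZl//; last first.
  apply: (@continuous_integrable_itv (fun x => h (F x))) => x.
  by apply: continuous_comp; [exact: cF|exact: ch].
rewrite /Rintegral (@integration_by_substitution_increasing _ F h a b)//.
- by congr fine; apply: eq_integral => x _; rewrite F'E /= mulrC.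
- by move=> x y _ _ xy; rewrite /F ltrD2r ltr_pM2l.
- by move=> x _; rewrite F'E; exact: cvg_cst.
- by rewrite F'E; exact: is_cvg_cst.
- by rewrite F'E; exact: is_cvg_cst.
- split; first by move=> x _; exact: (@ex_derive _ _ _ _ _ _ _ (dF x)).
    exact/cvg_at_right_filter/cF.
  exact/cvg_at_left_filter/cF.
- exact: continuous_subspaceT.
Qed.

Lemma Rintegral_itv_FTC (h F : R -> R) (a b : R) : continuous h -> a <= b ->
  (forall x : R, is_derive x 1 F (h x)) ->
  \int[mu]_(x in `[a, b]) h x = F b - F a.
Proof.
move=> ch; rewrite le_eqVlt => /predU1P[->|ab] dF.
  by rewrite set_itv1 Rintegral_set1 subrr.
have cF : continuous F.
  move=> x; apply/differentiable_continuous/derivable1_diffP.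
  exact: (@ex_derive _ _ _ _ _ _ _ (dF x)).
rewrite /Rintegral (@continuous_FTC2 _ _ F)//.
- exact: continuous_subspaceT.
- split; first by move=> x _; exact: (@ex_derive _ _ _ _ _ _ _ (dF x)).
    exact/cvg_at_right_filter/cF.
  exact/cvg_at_left_filter/cF.
- by move=> x _; rewrite derive1E; exact: (@derive_val _ _ _ _ _ _ _ (dF x)).
Qed.

Lemma Rintegral_itv_le (h g : R -> R) (a b : R) :
  continuous h -> continuous g -> (forall x, h x <= g x) ->
  \int[mu]_(x in `[a, b]) h x <= \int[mu]_(x in `[a, b]) g x.
Proof.
by move=> ch cg hg; apply: le_Rintegral => //; exact: continuous_integrable_itv.
Qed.

Lemma Rintegral01_cst (k : R) : \int[mu]_(x in `[0, 1]) k = k.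
Proof.
by rewrite Rintegral_cst//= lebesgue_measure_itv/= lte_fin ltr01 oppr0 addr0 /= mulr1.
Qed.

Section period1.
Variable h : R -> R.
Hypotheses (ch : continuous h) (ph : forall x, h (x + 1) = h x).

(** The interval [c, 1 + c] is cut at 1 and its second piece is moved back by
    one period. *)
Lemma Rintegral_periodic_shift (c : R) : 0 <= c <= 1 ->
  \int[mu]_(x in `[0, 1]) h (x + c) = \int[mu]_(x in `[0, 1]) h x.
Proof.
move=> /andP[c0 c1].
have E (a b k : R) : a <= b ->
    \int[mu]_(x in `[a + k, b + k]) h x = \int[mu]_(x in `[a, b]) h (x + k).
  move=> ab; have := Rintegral_itv_affine k ch ltr01 ab; rewrite !mul1r => ->.
  by under eq_Rintegral do rewrite mul1r.
have H1 : 0 + c <= 1 by lra.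
have H2 : 1 <= 1 + c by lra.
rewrite -(E _ _ _ ler01) (Rintegral_itv_split ch H1 H2).
have -> : \int[mu]_(x in `[1, 1 + c]) h x = \int[mu]_(x in `[0, c]) h x.
  have := E 0 c 1 c0; rewrite add0r (addrC c) => ->.
  by apply: eq_Rintegral => x _; rewrite ph.
by rewrite addrC add0r -Rintegral_itv_split.
Qed.

(** Doubling the variable sweeps two periods, at half weight. *)
Lemma Rintegral_periodic_double :
  \int[mu]_(x in `[0, 1]) h (2 * x) = \int[mu]_(x in `[0, 1]) h x.
Proof.
have k0 : 0 < 2 :> R by [].
have H2 : 1 <= 2 :> R by rewrite ler1n.
have := Rintegral_itv_affine 0 ch k0 ler01.
rewrite mulr0 mulr1 !addr0 (Rintegral_itv_split ch ler01 H2).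
have := Rintegral_itv_affine 1 ch ltr01 ler01.
rewrite mulr0 mulr1 add0r mul1r (_ : 1 + 1 = 2)// => ->.
under [X in _ + X]eq_Rintegral do rewrite mul1r ph.
under [X in _ = _ * X]eq_Rintegral do rewrite addr0.
lra.
Qed.
End period1.
End segment_integrals.

(** * Mean and variance of one random step *)
Section step_moments.
Variable R : realType.
Local Notation mu := (@lebesgue_measure R).

Lemma is_derive_affine (k c x : R) : is_derive x 1 (fun u => k * u + c) k.
Proof.
by apply: is_derive_eq; rewrite /GRing.scale /= ?mulr1 ?add0r ?mul1r ?mulr0 ?addr0.
Qed.

Lemma continuous_affine (k c : R) : continuous (fun u : R => k * u + c).
Proof.
move=> x; apply/differentiable_continuous/derivable1_diffP.
exact: (@ex_derive _ _ _ _ _ _ _ (is_derive_affine k c x)).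
Qed.

Lemma continuous_cos_affine (k c : R) : continuous (fun u : R => cos (k * u + c)).
Proof.
move=> x; apply: (@continuous_comp _ _ _ (fun u => k * u + c)).
  exact: continuous_affine.
exact: continuous_cos.
Qed.

Lemma continuous_rank_step_param (z : R) : continuous (fun u : R => rank_step u z).
Proof.
move=> u; apply: cvgD; first exact: cvg_cst.
by apply: cvgN; apply: cvgM; [exact: cvg_cst|exact: continuous_cos_affine].
Qed.

Lemma Rintegral_rank_step (z : R) : \int[mu]_(u in `[0, 1]) rank_step u z = z.
Proof.
pose s := sin (pi * z) / pi.
pose v (u : R) := 2 * pi * u + pi * z.
pose F := (fun u : R => z * u - s / (2 * pi) * (sin \o v) u).
have p0 := @pi_neq0 R.
have dF (x : R) : is_derive x 1 F (rank_step x z).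
  have dv : is_derive x 1 v (2 * pi) by exact: is_derive_affine.
  apply: is_derive_eq; rewrite /= /GRing.scale /= /rank_step -/s -/(v x).
  by rewrite /s; move: (sin _) (cos _) => S C; clear -p0; move: pi p0 => p p0; field.
rewrite (Rintegral_itv_FTC _ ler01 dF); last exact: continuous_rank_step_param.
have E : v 1 = v 0 + pi *+ 2 by rewrite /v -mulr_natr; ring.
by rewrite /F /= E sinD2pi; ring.
Qed.

Lemma Rintegral_rank_step_sqr (z : R) :
  \int[mu]_(u in `[0, 1]) (rank_step u z - z) ^+ 2 =
  sin (pi * z) ^+ 2 / (2 * pi ^+ 2).
Proof.
pose s := sin (pi * z) / pi.
pose v (u : R) := 4 * pi * u + 2 * pi * z.
pose F := (fun u : R => s ^+ 2 / 2 * (u + (4 * pi)^-1 * (sin \o v) u)).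
have p0 := @pi_neq0 R.
have sE (u : R) : (rank_step u z - z) ^+ 2 = s ^+ 2 / 2 * (1 + cos (v u)).
  rewrite /rank_step -/s; set q := 2 * pi * u + pi * z.
  have -> : v u = q *+ 2 by rewrite /v /q -mulr_natr; ring.
  by rewrite cos_mulr2n -mulr_natr; field.
have dF (x : R) : is_derive x 1 F ((rank_step x z - z) ^+ 2).
  have dv : is_derive x 1 v (4 * pi) by exact: is_derive_affine.
  apply: is_derive_eq; rewrite sE /= /GRing.scale /=.
  by rewrite /s; move: (sin _) (cos _) => S C; clear -p0; move: pi p0 => p p0; field.
rewrite (Rintegral_itv_FTC _ ler01 dF); last first.
  under eq_fun do rewrite sE; move=> u; apply: cvgM; first exact: cvg_cst.
  by apply: cvgD; [exact: cvg_cst|exact: continuous_cos_affine].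
have -> : F 1 = s ^+ 2 / 2 * (1 + (4 * pi)^-1 * sin (v 0)).
  have E : v 1 = v 0 + pi *+ 2 + pi *+ 2 by rewrite /v -mulr_natr; ring.
  by rewrite /F /= E !sinD2pi.
rewrite /F /= /s; move: (sin _) (sin _) => A B; clear -p0; move: pi p0 => p p0.
by field.
Qed.
End step_moments.

(** * The logarithm of |1 - r e^(2 i pi u)|^2 *)
Section log_kernel.
Variable R : realType.
Local Notation mu := (@lebesgue_measure R).

(** The logarithm of |1 - r e^(2 i pi u)|^2, a harmonic function of
    r e^(2 i pi u) in the open unit disc that vanishes at the centre. *)
Definition log_kernel (r u : R) : R := ln (1 + r ^+ 2 - 2 * r * cos (2 * pi * u)).

Lemma kernel_ge (r u : R) : 0 <= r ->
  (1 - r) ^+ 2 <= 1 + r ^+ 2 - 2 * r * cos (2 * pi * u).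
Proof. by move=> r0; have := cos_le1 (2 * pi * u); nra. Qed.

Lemma kernel_gt0 (r u : R) : 0 <= r < 1 ->
  0 < 1 + r ^+ 2 - 2 * r * cos (2 * pi * u).
Proof.
move=> /andP[r0 r1]; apply: lt_le_trans (kernel_ge u r0).
by rewrite exprn_gt0// subr_gt0.
Qed.

Lemma continuous_log_kernel (r : R) : 0 <= r < 1 -> continuous (log_kernel r).
Proof.
move=> r01 u; apply: continuous_comp; last exact/continuous_ln/kernel_gt0.
apply: cvgD; first exact: cvg_cst.
apply: cvgN; apply: cvgM; first exact: cvg_cst.
have -> : (fun u : R => cos (2 * pi * u)) = (fun u => cos (2 * pi * u + 0)).
  by apply/funext => x; rewrite addr0.
rewrite -[X in cos X]addr0; exact: continuous_cos_affine.
Qed.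

Lemma log_kernel_periodic (r u : R) : log_kernel r (u + 1) = log_kernel r u.
Proof.
rewrite /log_kernel; congr (ln (_ - _ * _)).
by rewrite mulrDr mulr1 mulr_natl cosD2pi.
Qed.

Lemma log_kernel_le (r u : R) : 0 <= r < 1 -> log_kernel r u <= ln 4.
Proof.
move=> r01; rewrite ler_ln ?posrE ?kernel_gt0//.
have := cos_geN1 (2 * pi * u); nra.
Qed.

Lemma log_kernel_ge (r u : R) : 0 <= r < 1 -> ln ((1 - r) ^+ 2) <= log_kernel r u.
Proof.
move=> r01; rewrite ler_ln ?posrE ?kernel_gt0//; last by rewrite exprn_gt0//; lra.
by apply: kernel_ge; lra.
Qed.

(** With w = r e^(2 i pi u), this is |1 - w|^2 |1 + w|^2 = |1 - w^2|^2. *)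
Lemma log_kernel_double (r u : R) : 0 <= r < 1 ->
  log_kernel r u + log_kernel r (u + 1 / 2) = log_kernel (r ^+ 2) (2 * u).
Proof.
move=> r01; have r2 : 0 <= r ^+ 2 < 1 by nra.
rewrite -lnM ?posrE ?kernel_gt0//; congr ln.
have -> : 2 * pi * (u + 1 / 2) = 2 * pi * u + pi :> R.
  by move: pi => p; field.
have -> : 2 * pi * (2 * u) = (2 * pi * u) *+ 2 by rewrite -mulr_natr; ring.
by rewrite cosDpi cos_mulr2n -mulr_natr; ring.
Qed.

(** Iterating the hypothesis m times bounds f rho by K / 2^m + 2 B, because
    squaring does not leave [0, rho]. *)
Lemma halving_bound (f : R -> R) (K B rho : R) : 0 <= rho < 1 -> 0 <= B ->
  (forall r, 0 <= r <= rho -> f r <= K) ->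
  (forall r, 0 <= r < 1 -> f r <= f (r ^+ 2) / 2 + B) ->
  f rho <= 2 * B.
Proof.
move=> rho1 B0 fK fh.
have H m r : 0 <= r <= rho -> f r <= `|K| / 2 ^+ m + 2 * B.
  elim: m r => [|m IH] r r0.
    by rewrite expr0 divr1; have := fK _ r0; have := ler_norm K; lra.
  have r20 : 0 <= r ^+ 2 <= rho by nra.
  have r1 : 0 <= r < 1 by lra.
  have := fh _ r1; have := IH _ r20; rewrite [2 ^+ m.+1]exprS invfM.
  have : (0 : R) < 2 ^+ m by exact: exprn_gt0.
  set q := 2 ^+ m => q0 h1 h2.
  have -> : `|K| * (2^-1 / q) = `|K| / q / 2 by ring.
  lra.
apply/ler_addgt0Pr => e e0.
have [m hm] : exists m, `|K| / 2 ^+ m <= e.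
  exists (Num.truncn (`|K| / e)).+1; rewrite ler_pdivrMr ?exprn_gt0// mulrC -ler_pdivrMr//.
  apply: le_trans (_ : (Num.truncn (`|K| / e)).+1%:R <= _).
    exact/ltW/truncnS_gt.
  by rewrite -natrX ler_nat ltnW// ltn_expl.
by apply: le_trans (H m rho _) _; lra.
Qed.

Lemma log_kernel_bound (rho r u : R) : 0 <= rho < 1 -> 0 <= r <= rho ->
  `|log_kernel r u| <= ln 4 - ln ((1 - rho) ^+ 2).
Proof.
move=> rho1 r0; have r1 : 0 <= r < 1 by lra.
have h1 := log_kernel_le u r1; have h2 := log_kernel_ge u r1.
have h3 : ln ((1 - rho) ^+ 2) <= ln ((1 - r) ^+ 2).
  rewrite ler_ln ?posrE ?exprn_gt0//; [|lra|lra]; nra.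
have h4 : 0 <= ln 4 :> R by apply: ln_ge0; rewrite ler1n.
have h5 : ln ((1 - rho) ^+ 2) <= 0 by apply: ln_le0; nra.
by rewrite ler_norml; apply/andP; split; lra.
Qed.

(** The mean value property at the centre of the disc. The mean M satisfies
    M r = M (r^2) / 2 by the duplication formula and is bounded on [0, r], so
    [halving_bound] applies to M and to - M with B = 0. *)
Lemma Rintegral_log_kernel (r : R) : 0 <= r < 1 ->
  \int[mu]_(u in `[0, 1]) log_kernel r u = 0.
Proof.
move=> r01; pose M r := \int[mu]_(u in `[0, 1]) log_kernel r u.
have double s : 0 <= s < 1 -> M s = M (s ^+ 2) / 2.
  move=> s01; have s2 : 0 <= s ^+ 2 < 1 by nra.
  have cs := continuous_log_kernel s01.
  have E : M s + M s = M (s ^+ 2).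
    rewrite {2}/M -(@Rintegral_periodic_shift _ _ cs (log_kernel_periodic s) (1/2)); last lra.
    rewrite -RintegralD//; last 2 first.
    - exact: continuous_integrable_itv.
    - apply: (@continuous_integrable_itv _ (fun u => log_kernel s (u + 1/2))) => x.
      apply: (@continuous_comp _ _ _ (fun u : R => u + 1 / 2)); last exact: cs.
      by apply: cvgD; [exact: cvg_id|exact: cvg_cst].
    under eq_Rintegral do rewrite log_kernel_double//.
    apply: (@Rintegral_periodic_double _ (log_kernel (s ^+ 2))).
      exact: continuous_log_kernel.
    exact: log_kernel_periodic.
  lra.
have bnd s : 0 <= s <= r -> `|M s| <= ln 4 - ln ((1 - r) ^+ 2).
  move=> sr; have s1 : 0 <= s < 1 by lra.
  have cs := continuous_log_kernel s1.
  have hs u := log_kernel_bound u r01 sr.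
  set K := _ - _ in hs *; rewrite ler_norml; apply/andP; split.
    rewrite -(Rintegral01_cst (- K)).
    apply: Rintegral_itv_le => //; first exact: cst_continuous.
    by move=> u; have := hs u; rewrite ler_norml => /andP[].
  rewrite -(Rintegral01_cst K).
  apply: Rintegral_itv_le => //; first exact: cst_continuous.
  by move=> u; have := hs u; rewrite ler_norml => /andP[].
have M1 : M r <= 2 * 0.
  apply: (@halving_bound M (ln 4 - ln ((1 - r) ^+ 2))) => // s s01.
    by have := bnd _ s01; rewrite ler_norml => /andP[].
  by rewrite (double s s01) addr0.
have M2 : - M r <= 2 * 0.
  apply: (@halving_bound (fun s => - M s) (ln 4 - ln ((1 - r) ^+ 2))) => // s s01.
    by have := bnd _ s01; rewrite ler_norml => /andP[]; lra.
  by rewrite (double s s01); lra.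
rewrite -/(M r); lra.
Qed.

(** The bound must be uniform in r < 1, although the kernel is unbounded below
    as r tends to 1. If x, y <= l and c = x + y, then (l - x) (l - y) >= 0 gives
    x^2 + y^2 <= c^2 - 2 l c + 2 l^2. With l = ln 4 and the duplication formula,
    and since the kernel has mean zero, the second moment M satisfies
    2 M r <= M (r^2) + 2 l^2, and [halving_bound] concludes. *)
Lemma Rintegral_log_kernel_sqr (r : R) : 0 <= r < 1 ->
  \int[mu]_(u in `[0, 1]) (log_kernel r u) ^+ 2 <= 2 * (ln 4) ^+ 2.
Proof.
move=> r01; pose M r := \int[mu]_(u in `[0, 1]) (log_kernel r u) ^+ 2.
pose K := (ln 4 - ln ((1 - r) ^+ 2)).
have csqr s : 0 <= s < 1 -> continuous (fun u => log_kernel s u ^+ 2).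
  move=> s01 x; have h := continuous_log_kernel s01 (x := x).
  exact: (cvgM h h).
apply: (@halving_bound M (K ^+ 2)) => //; first exact: sqr_ge0.
  move=> s sr; have s1 : 0 <= s < 1 by lra.
  rewrite -[X in _ <= X]Rintegral01_cst.
  apply: Rintegral_itv_le; [exact: csqr|exact: cst_continuous|] => u.
  have := log_kernel_bound u r01 sr; rewrite -/K -(real_normK (num_real (log_kernel s u))).
  by move=> h; rewrite ler_pXn2r// nnegrE; have := normr_ge0 (log_kernel s u); lra.
move=> s s01; have s2 : 0 <= s ^+ 2 < 1 by nra.
have cs := continuous_log_kernel s01.
(* g and k are the two sides of the inequality on squares. *)
pose g u := (log_kernel s u) ^+ 2 + (log_kernel s (u + 1/2)) ^+ 2.
pose k u := (log_kernel (s ^+ 2) (2 * u)) ^+ 2 - 2 * ln 4 * log_kernel (s ^+ 2) (2 * u)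
  + 2 * ln 4 ^+ 2.
have cshift : continuous (fun u : R => log_kernel s (u + 1/2)).
  move=> x; apply: (@continuous_comp _ _ _ (fun u : R => u + 1 / 2)); last exact: cs.
  by apply: cvgD; [exact: cvg_id|exact: cvg_cst].
have cdbl : continuous (fun u : R => log_kernel (s ^+ 2) (2 * u)).
  move=> x; apply: (@continuous_comp _ _ _ (fun u : R => 2 * u)); last exact: continuous_log_kernel.
  by apply: cvgM; [exact: cvg_cst|exact: cvg_id].
have gk u : g u <= k u.
  rewrite /g /k -log_kernel_double//.
  have := log_kernel_le u s01; have := log_kernel_le (u + 1/2) s01; nra.
have cg : continuous g by move=> x; apply: cvgD; [exact: (cvgM (cs x) (cs x))|exact: (cvgM (cshift x) (cshift x))].
have cdbl2 : continuous (fun u : R => log_kernel (s ^+ 2) (2 * u) ^+ 2).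
  by move=> x; exact: (cvgM (cdbl x) (cdbl x)).
have cdbl3 : continuous (fun u : R => 2 * ln 4 * log_kernel (s ^+ 2) (2 * u)).
  by move=> x; apply: cvgM; [exact: cvg_cst|exact: cdbl].
have cdbl4 : continuous (fun u : R => log_kernel (s ^+ 2) (2 * u) ^+ 2 - 2 * ln 4 * log_kernel (s ^+ 2) (2 * u)).
  by move=> x; apply: cvgB; [exact: cdbl2|exact: cdbl3].
have ck : continuous k by move=> x; apply: cvgD; [exact: cdbl4|exact: cvg_cst].
have := @Rintegral_itv_le _ g k 0 1 cg ck gk.
have -> : \int[mu]_(x in `[0, 1]) g x = M s + M s.
  rewrite RintegralD//; [|exact: continuous_integrable_itv (csqr _ s01)|].
    congr (_ + _).
    apply: (@Rintegral_periodic_shift _ (fun u => log_kernel s u ^+ 2)); first exact: csqr.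
      by move=> x; rewrite log_kernel_periodic.
    lra.
  by apply: continuous_integrable_itv => x; exact: (cvgM (cshift x) (cshift x)).
have -> : \int[mu]_(x in `[0, 1]) k x = M (s ^+ 2) + 2 * ln 4 ^+ 2.
  rewrite RintegralD//; last 2 first.
  - exact: continuous_integrable_itv.
  - by apply: continuous_integrable_itv; exact: cst_continuous.
  rewrite RintegralB//; [|exact: continuous_integrable_itv..].
  rewrite RintegralZl//; [|exact: continuous_integrable_itv..].
  rewrite Rintegral01_cst.
  rewrite (@Rintegral_periodic_double _ (fun u => log_kernel (s ^+ 2) u ^+ 2)); last 2 first.
  - exact: csqr.
  - by move=> x; rewrite log_kernel_periodic.
  rewrite (@Rintegral_periodic_double _ (log_kernel (s ^+ 2))); last 2 first.
  - exact: continuous_log_kernel.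
  - by move=> x; rewrite log_kernel_periodic.
  by rewrite Rintegral_log_kernel// mulr0 subr0.
lra.
Qed.

End log_kernel.

(** * A strong law for nonnegative uncorrelated variables *)
Section summable_ae.
Local Open Scope ereal_scope.
Context d (T : measurableType d) (R : realType) (P : probability T R).

(** The series of the X n has finite mean, hence is almost surely finite, and
    the terms of a convergent series tend to 0. *)
Lemma ae_cvg0_summable (X : nat -> T -> R) (B : R) :
  (forall n, measurable_fun setT (X n)) -> (forall n w, (0 <= X n w)%R) ->
  (forall N, \sum_(0 <= n < N) \int[P]_w (X n w)%:E <= B%:E) ->
  {ae P, forall w, X n w @[n --> \oo] --> (0 : R)%R}.
Proof.
move=> mX X0 XB.
have mXE n : measurable_fun setT (EFin \o X n) by exact/measurable_EFinP.
pose s w := \sum_(n <oo) (X n w)%:E.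
have s0 w : 0 <= s w by apply: nneseries_ge0 => n _ _; rewrite lee_fin.
have ms : measurable_fun setT s.
  apply: (@ge0_emeasurable_sum _ _ _ setT (fun n w => (X n w)%:E) xpredT) => [k w _ _|k _].
    by rewrite lee_fin.
  exact: mXE.
have is_ : P.-integrable setT s.
  apply/integrableP; split=> //.
  under eq_integral do rewrite gee0_abs//.
  have X0E n w : setT w -> 0 <= (EFin \o X n) w by rewrite lee_fin.
  rewrite (integral_nneseries P measurableT mXE X0E).
  apply: le_lt_trans (ltry B).
  apply: lime_le; last by apply: nearW => N; exact: XB.
  apply: is_cvg_nneseries => n _ _; apply: integral_ge0 => w _.
  by rewrite lee_fin.
have := integrable_ae measurableT is_; apply: filterS => w /(_ I) sw.
have tail := @nneseries_tail_cvg R (fun n => (X n w)%:E) xpredT.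
have /tail {}tail : s w < +oo by rewrite -ge0_fin_numE.
have {}tail := tail (fun k _ => X0 k w : 0 <= (X k w)%:E).
suff : (X n w)%:E @[n --> \oo] --> 0 by move/fine_cvg.
apply: (squeeze_cvge _ (cvg_cst 0) tail); apply: nearW => n.
rewrite lee_fin X0 /=; apply: le_trans (nneseries_lim_ge n.+1 _).
  by rewrite big_nat1.
by move=> k _ _; rewrite lee_fin.
Qed.
End summable_ae.

Section strong_law.
Variable R : realType.

Lemma sqrt_bracket (n : nat) : exists m, (m ^ 2 <= n < m.+1 ^ 2)%N.
Proof.
elim: n => [|n [m /andP[mn nm]]]; first by exists 0%N.
have [h|h] := ltnP n.+1 (m.+1 ^ 2).
  by exists m; rewrite h leqW.
exists m.+1; rewrite h /=; apply: (leq_ltn_trans nm).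
by rewrite ltn_exp2r.
Qed.

(** Between consecutive squares m^2 <= n < (m+1)^2 monotonicity encloses S n / n
    between S (m^2) / (m+1)^2 and S ((m+1)^2) / m^2, and the ratio of
    consecutive squares tends to 1. *)
Lemma cvg_mean_of_squares (S : nat -> R) (l : R) :
  (forall n, 0 <= S n) -> {homo S : m n / (m <= n)%N >-> m <= n} ->
  S (m.+1 ^ 2)%N / (m.+1 ^ 2)%:R @[m --> \oo] --> l ->
  S n / n%:R @[n --> \oo] --> l.
Proof.
move=> S0 Snd Sl.
pose q (m : nat) : R := m.+1%:R / m%:R.
have ql : q m @[m --> \oo] --> (1 : R).
  have h : 1 + (m.+1%:R)^-1 @[m --> \oo] --> (1 : R).
    rewrite -[X in _ --> X]addr0; apply: cvgD; first exact: cvg_cst.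
    exact: cvg_harmonic.
  rewrite -cvg_shiftS; apply: cvg_trans h; apply: near_eq_cvg; apply: nearW => m.
  rewrite /= (_ : q m.+1 = (m.+1%:R + 1) / m.+1%:R); last by rewrite /q natr1.
  by rewrite mulrDl divff ?pnatr_eq0// mul1r.
pose u m := S (m ^ 2)%N / (m.+1 ^ 2)%:R.
pose v m := S (m.+1 ^ 2)%N / (m ^ 2)%:R.
have vl : v m @[m --> \oo] --> l.
  have h : S (m.+1 ^ 2)%N / (m.+1 ^ 2)%:R * (q m * q m) @[m --> \oo] --> l.
    by rewrite -(mulr1 l) -{2}(mulr1 1); apply: cvgM => //; exact: cvgM.
  apply: cvg_trans h.
  apply: near_eq_cvg; exists 1%N => // m /= m1.
  have m0 : m%:R != 0 :> R by rewrite pnatr_eq0 -lt0n.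
  have h1 : m.+1%:R != 0 :> R by rewrite pnatr_eq0.
  rewrite /v /q !natrX; move: h1 m0 (S _); move: m.+1%:R m%:R => a b a0 b0 s.
  by field; rewrite a0 b0.
have ul : u m @[m --> \oo] --> l.
  rewrite -cvg_shiftS.
  have q2 : (q m.+1)^-1 @[m --> \oo] --> (1 : R).
    by rewrite -[X in _ --> X]invr1; apply: cvgV => //; rewrite cvg_shiftS.
  have h : S (m.+1 ^ 2)%N / (m.+1 ^ 2)%:R * ((q m.+1)^-1 * (q m.+1)^-1)
      @[m --> \oo] --> l.
    by rewrite -(mulr1 l) -{2}(mulr1 1); apply: cvgM => //; exact: cvgM.
  apply: cvg_trans h.
  apply: near_eq_cvg; apply: nearW => m.
  have h1 : m.+1%:R != 0 :> R by rewrite pnatr_eq0.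
  have h2 : m.+2%:R != 0 :> R by rewrite pnatr_eq0.
  rewrite /= /u /q !natrX; move: h1 h2 (S _); move: m.+1%:R m.+2%:R => a b a0 b0 s.
  by field; rewrite a0 b0.
apply/cvgrPdist_le => e e0.
move/cvgrPdist_le: ul => /(_ _ e0)[M1 _ hu].
move/cvgrPdist_le: vl => /(_ _ e0)[M2 _ hv].
pose M := (maxn 1 (maxn M1 M2)).
exists (M ^ 2)%N => // n /= Mn.
have [m /andP[mn nm]] := sqrt_bracket n.
have Mm : (M <= m)%N.
  by rewrite -ltnS -(@ltn_exp2r _ _ 2)//; exact: leq_ltn_trans Mn nm.
have := hu m; have := hv m; rewrite /=.
have [m1 m2] : (M1 <= m)%N /\ (M2 <= m)%N.
  by split; apply: leq_trans Mm; rewrite /M !leq_max leqnn !orbT.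
have m0 : (0 < m)%N by apply: leq_trans Mm; rewrite /M leq_max.
have n0 : (0 < n)%N by apply: leq_trans mn; rewrite expn_gt0 m0.
move=> /(_ m2) + /(_ m1); rewrite !ler_distlC => /andP[_ hv'] /andP[hu' _].
apply/andP; split.
  apply: le_trans hu' _; rewrite /u ler_pM ?invr_ge0//; first exact: Snd.
  by rewrite lef_pV2 ?posrE ?ltr0n// ?expn_gt0// ler_nat ltnW.
apply: le_trans hv'; rewrite /v ler_pM ?invr_ge0//; first by apply/Snd/ltnW.
by rewrite lef_pV2 ?posrE ?ltr0n// ?expn_gt0 ?m0// ler_nat.
Qed.

(** Telescoping comparison of 1 / (m+1)^2 with 1 / m - 1 / (m+1). *)
Lemma sum_inv_sqr_le (N : nat) : \sum_(0 <= m < N) (m.+1 ^ 2)%:R^-1 <= 2 :> R.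
Proof.
case: N => [|N]; first by rewrite big_geq.
suff H : \sum_(0 <= m < N.+1) (m.+1 ^ 2)%:R^-1 <= 2 - (N.+1%:R)^-1 :> R.
  by apply: le_trans H _; rewrite gerBl invr_ge0.
elim: N => [|N IH]; first by rewrite big_nat1 invr1; lra.
rewrite big_nat_recr//=; apply: le_trans (lerD IH (lexx _)) _.
rewrite natrX -[N.+2%:R]natr1.
have : 1 <= N.+1%:R :> R by rewrite ler1n.
move: (N.+1%:R) => x x1.
rewrite -subr_ge0.
have -> : 2 - (x + 1)^-1 - (2 - x^-1 + (x + 1) ^- 2) = (x * (x + 1) ^+ 2)^-1 :> R.
  by field; apply/andP; split; lra.
by rewrite invr_ge0 mulr_ge0 ?sqr_ge0//; lra.
Qed.

Local Open Scope ereal_scope.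
Context d (T : measurableType d) (P : probability T R).

(** Nonpositive correlation of X n with the previous partial sum makes the
    variance of S n at most n C. Along squares the deviations S n / n - l then
    have summable second moments, so they tend to 0 almost surely; since the
    terms are nonnegative, the partial sums are monotone and the other indices
    follow. *)
Lemma strong_law_nonneg (X : nat -> T -> R) (l C : R) :
  (forall n, measurable_fun setT (X n)) -> (forall n w, (0 <= X n w)%R) ->
  (0 <= C)%R ->
  (forall n, \int[P]_w (X n w)%:E = l%:E) ->
  (forall n, \int[P]_w ((\sum_(0 <= i < n) X i w) * X n w)%:E <= (n%:R * l ^+ 2)%:E) ->
  (forall n, \int[P]_w (X n w ^+ 2)%:E <= C%:E) ->
  {ae P, forall w, ((\sum_(0 <= i < n) X i w) / n%:R)%R @[n --> \oo] --> l}.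
Proof.
move=> mX X0 C0 EX EXX EX2; pose S n w := (\sum_(0 <= i < n) X i w)%R.
have S0 n w : (0 <= S n w)%R by apply: sumr_ge0.
have mS n : measurable_fun setT (S n) by exact: measurable_sum.
have SS n w : S n.+1 w = (S n w + X n w)%R by rewrite /S big_nat_recr.
have l0 : (0 <= l)%R.
  by rewrite -lee_fin -(EX 0%N); apply: integral_ge0 => w _; rewrite lee_fin.
have ES n : \int[P]_w (S n w)%:E = (n%:R * l)%:E.
  elim: n => [|n IH].
    by under eq_integral do rewrite /S big_geq//; rewrite integral0 mul0r.
  under eq_integral do rewrite SS EFinD.
  rewrite ge0_integralD//=; [|by move=> w _; rewrite lee_fin|exact/measurable_EFinP|
    by move=> w _; rewrite lee_fin|exact/measurable_EFinP].
  by rewrite IH EX -EFinD -natr1 mulrDl mul1r.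
have ES2 n : \int[P]_w (S n w ^+ 2)%:E <= (n%:R * C + n%:R ^+ 2 * l ^+ 2)%:E.
  elim: n => [|n IH].
    under eq_integral do rewrite /S big_geq// expr0n /=.
    by rewrite integral0 !mul0r expr0n mul0r addr0.
  have E w : (S n.+1 w ^+ 2)%:E =
      (S n w ^+ 2)%:E + (2%:E * (S n w * X n w)%:E + (X n w ^+ 2)%:E).
    by rewrite SS -EFinM -!EFinD; congr EFin; ring.
  under eq_integral do rewrite E.
  have m1 : measurable_fun setT (fun w => (S n w ^+ 2)%:E).
    by apply/measurable_EFinP; exact: measurable_funX.
  have m2 : measurable_fun setT (fun w => (S n w * X n w)%:E).
    by apply/measurable_EFinP; exact: measurable_funM.
  have m3 : measurable_fun setT (fun w => (X n w ^+ 2)%:E).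
    by apply/measurable_EFinP; exact: measurable_funX.
  have m4 : measurable_fun setT (fun w => 2%:E * (S n w * X n w)%:E).
    exact: measurable_funeM.
  have p1 w : setT w -> 0 <= (S n w ^+ 2)%:E by rewrite lee_fin sqr_ge0.
  have p2 w : setT w -> 0 <= (S n w * X n w)%:E by rewrite lee_fin mulr_ge0.
  have p3 w : setT w -> 0 <= (X n w ^+ 2)%:E by rewrite lee_fin sqr_ge0.
  have p4 w : setT w -> 0 <= 2%:E * (S n w * X n w)%:E by move=> h; rewrite mule_ge0 ?p2.
  rewrite ge0_integralD//; last 2 first.
    by move=> w h; rewrite adde_ge0 ?p3 ?p4.
    exact: emeasurable_funD.
  rewrite ge0_integralD// ge0_integralZl_EFin//.
  have h1 : 2%:E * \int[P]_w (S n w * X n w)%:E <= 2%:E * (n%:R * l ^+ 2)%:E.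
    by apply: lee_wpmul2l; [rewrite lee_fin|exact: EXX].
  apply: le_trans (leeD IH (leeD h1 (EX2 n))) _.
  rewrite -EFinM -!EFinD lee_fin -natr1; have := sqr_ge0 l; nra.
(* The cross term is moved to the other side, so that only nonnegative
   functions are integrated. *)
have ED n : \int[P]_w ((S n w - n%:R * l) ^+ 2)%:E <= (n%:R * C)%:E.
  have mD : measurable_fun setT (fun w => ((S n w - n%:R * l) ^+ 2)%:E).
    by apply/measurable_EFinP; apply: measurable_funX; exact: measurable_funB.
  have : \int[P]_w (((S n w - n%:R * l) ^+ 2)%:E + (2 * n%:R * l)%:E * (S n w)%:E)
      = \int[P]_w ((S n w ^+ 2)%:E + ((n%:R * l) ^+ 2)%:E).
    by apply: eq_integral => w _; rewrite -EFinM -!EFinD; congr EFin; ring.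
  have nl0 : (0 <= n%:R * l)%R by rewrite mulr_ge0.
  rewrite ge0_integralD//=; last 3 first.
  - by move=> w _; rewrite lee_fin sqr_ge0.
  - by move=> w _; rewrite -EFinM lee_fin -mulrA !mulr_ge0.
  - by apply: measurable_funeM; exact/measurable_EFinP.
  rewrite ge0_integralZl_EFin//; last 3 first.
  - by move=> w _; rewrite lee_fin.
  - exact/measurable_EFinP.
  - by rewrite -mulrA mulr_ge0.
  rewrite ES ge0_integralD//=; last 3 first.
  - by move=> w _; rewrite lee_fin sqr_ge0.
  - by apply/measurable_EFinP; exact: measurable_funX.
  - by move=> w _; rewrite lee_fin sqr_ge0.
  rewrite integral_cst//= probability_setT mule1 -EFinM => E.
  have : \int[P]_w ((S n w - n%:R * l) ^+ 2)%:E + (2 * n%:R * l * (n%:R * l))%:E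
     <= (n%:R * C)%:E + (2 * n%:R * l * (n%:R * l))%:E.
    rewrite E; apply: le_trans (leeD (ES2 n) (lexx _)) _.
    by rewrite -!EFinD lee_fin; rewrite le_eqVlt; apply/orP; left; apply/eqP; ring.
  by rewrite leeD2rE.
pose Y m w := ((S (m.+1 ^ 2)%N w / (m.+1 ^ 2)%:R - l) ^+ 2)%R.
have YE m w : Y m w = (((m.+1 ^ 2)%:R ^- 2) * (S (m.+1 ^ 2)%N w - (m.+1 ^ 2)%:R * l) ^+ 2)%R.
  have h : ((m.+1 ^ 2)%:R != 0 :> R)%R by rewrite pnatr_eq0.
  by rewrite /Y; move: h (S _ w); move: (_%:R)%R => a a0 s; field.
have mY m : measurable_fun setT (Y m).
  apply: measurable_funX; apply: measurable_funB => //.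
  exact: measurable_funM.
have : {ae P, forall w, Y m w @[m --> \oo] --> (0 : R)%R}.
  apply: (@ae_cvg0_summable _ _ _ _ _ (C * 2)%R) => [//|m w|N]; first exact: sqr_ge0.
  apply: (@le_trans _ _ (\sum_(0 <= m < N) (C * (m.+1 ^ 2)%:R^-1)%:E)).
    apply: lee_sum => m _; under eq_integral do rewrite YE EFinM.
    rewrite ge0_integralZl_EFin//; last 2 first.
    - by move=> w _; rewrite lee_fin sqr_ge0.
    - by apply/measurable_EFinP; apply: measurable_funX; exact: measurable_funB.
    apply: le_trans (lee_wpmul2l _ (ED _)) _; first by rewrite lee_fin invr_ge0 sqr_ge0.
    rewrite -EFinM lee_fin.
    have h : ((m.+1 ^ 2)%:R != 0 :> R)%R by rewrite pnatr_eq0.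
    by rewrite le_eqVlt; apply/orP; left; apply/eqP; move: h; move: (_%:R)%R => a a0; field.
  rewrite sumEFin lee_fin -mulr_sumr ler_wpM2l//.
  exact: sum_inv_sqr_le.
apply: filterS => w Yw; apply: (@cvg_mean_of_squares (S ^~ w)) => //.
  by apply: homo_leq => [//|x y z|n]; [exact: le_trans|rewrite SS lerDl].
apply/cvgrPdist_lt => e e0; move/cvgrPdist_lt : Yw => /(_ (e ^+ 2)%R).
rewrite exprn_gt0// => /(_ isT); apply: filterS => m.
rewrite sub0r normrN ger0_norm ?sqr_ge0// /Y => h.
rewrite distrC -(@ltr_pXn2r _ 2) ?nnegrE// ?(ltW e0)//.
by rewrite real_normK// num_real.
Qed.
End strong_law.

(** * Deterministic rank orbits *)
Section rank_orbit_facts.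
Variable R : realType.
Implicit Types (a : nat -> R) (z : R).

Lemma rank_orbit_itv a n z : 0 <= z <= 1 -> 0 <= rank_orbit a n z <= 1.
Proof.
move=> z01; elim: n => //= n IH; rewrite rank_mapE ?rank_step_itv//.
by case/andP: IH.
Qed.

Lemma rank_orbitS a n z : 0 <= z <= 1 ->
  rank_orbit a n.+1 z = rank_step (a n) (rank_orbit a n z).
Proof. by move=> /(rank_orbit_itv a n)/andP[z0 _]; rewrite /= rank_mapE. Qed.

Lemma rank_orbit_itv_oo a n z : 0 < z < 1 -> 0 < rank_orbit a n z < 1.
Proof.
move=> /andP[z0 z1]; elim: n => [|n IH]; first exact/andP.
by rewrite rank_orbitS ?rank_step_gt0 ?rank_step_lt1//; lra.
Qed.

Lemma rank_orbit_nd a n z y : 0 <= z -> z <= y -> y <= 1 ->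
  rank_orbit a n z <= rank_orbit a n y.
Proof.
move=> z0 zy y1; elim: n => // n IH.
by rewrite !rank_orbitS ?rank_step_nd//; lra.
Qed.

Lemma rank_orbit_dist a n z : 0 <= z <= 1 ->
  `|rank_orbit a n.+1 z - rank_orbit a n z| <= sin (pi * rank_orbit a n z) / pi.
Proof. by move=> z01; rewrite rank_orbitS// rank_step_dist// rank_orbit_itv. Qed.

(** Once sin (pi z_n) < 3/16, the orbit stays outside [1/4, 3/4] and moves by at
    most 1/8 at each step, so it stays on one side; there the product
    z_n (1 - z_n) <= sin (pi z_n) controls the distance to the end point. *)
Lemma rank_orbit_dichotomy a z : 0 <= z <= 1 ->
  sin (pi * rank_orbit a n z) ^+ 2 @[n --> \oo] --> (0 : R) ->
  (rank_orbit a n z @[n --> \oo] --> (0 : R)) \/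
  (rank_orbit a n z @[n --> \oo] --> (1 : R)).
Proof.
move=> z01 s20; pose s n := sin (pi * rank_orbit a n z).
have sge n : rank_orbit a n z * (1 - rank_orbit a n z) <= s n.
  exact/sin_pi_ge/rank_orbit_itv.
have s0 : s n @[n --> \oo] --> (0 : R).
  apply/cvgrPdist_lt => e e0; move/cvgrPdist_lt : s20 => /(_ (e ^+ 2)).
  rewrite exprn_gt0// => /(_ isT); apply: filterS => n.
  rewrite !sub0r !normrN normrX => h.
  by rewrite -(@ltr_pXn2r _ 2) ?nnegrE// ltW.
have [N _ HN] : \forall n \near \oo, `|0 - s n| < 3 / 16.
  by move/cvgrPdist_lt : s0; apply; lra.
have {}HN n : (N <= n)%N -> s n < 3 / 16.
  by move=> /HN /=; rewrite sub0r normrN => /(le_lt_trans (ler_norm _)).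
have side n : (N <= n)%N ->
    rank_orbit a n z < 1 / 4 \/ 3 / 4 < rank_orbit a n z.
  move=> /HN; have := sge n; have := rank_orbit_itv a n z01.
  move: (s n) (rank_orbit a n z) => S x x01 h1 h2.
  have [h|h] := ltP x (1/4); first by left.
  right; rewrite ltNge; apply/negP => h'; nra.
have jump n : (N <= n)%N -> `|rank_orbit a n.+1 z - rank_orbit a n z| <= 1 / 8.
  move=> /HN sn; apply: le_trans (rank_orbit_dist a n z01) _; rewrite -/(s n).
  rewrite ler_pdivrMr ?pi_gt0//; have := @pi_ge2 R; nra.
have [lo|hi] := side N (leqnn _).
- left.
  have lo' n : (N <= n)%N -> rank_orbit a n z < 1 / 4.
    move=> /subnK <-; elim: (n - N)%N => // k IH.
    have := jump _ (leq_addl k N); have := side _ (leqW (leq_addl k N)).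
    rewrite addSn ler_norml; lra.
  have h : 4 / 3 * s n @[n --> \oo] --> (0 : R).
    by rewrite -(mulr0 (4 / 3)); apply: cvgM => //; exact: cvg_cst.
  apply: (squeeze_cvgr _ (cvg_cst 0) h); exists N => // n /= /lo' hn.
  have := sge n; have := rank_orbit_itv a n z01.
  by move: (s n) (rank_orbit a n z) hn => S x; nra.
- right.
  have hi' n : (N <= n)%N -> 3 / 4 < rank_orbit a n z.
    move=> /subnK <-; elim: (n - N)%N => // k IH.
    have := jump _ (leq_addl k N); have := side _ (leqW (leq_addl k N)).
    rewrite addSn ler_norml; lra.
  have h : 1 - 4 / 3 * s n @[n --> \oo] --> (1 : R).
    rewrite -[X in _ --> X]subr0 -(mulr0 (4 / 3)).
    by apply: cvgB; [exact: cvg_cst|apply: cvgM => //; exact: cvg_cst].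
  have h1 : (fun=> 1) @ \oo --> (1 : R) by exact: cvg_cst.
  apply: (squeeze_cvgr _ h h1); exists N => // n /= /hi' hn.
  have := sge n; have := rank_orbit_itv a n z01.
  by move: (s n) (rank_orbit a n z) hn => S x; nra.
Qed.

End rank_orbit_facts.

(** * The random rank orbit as a martingale *)
Section orbit_moments.
Context (R : realType) d (T : measurableType d) (P : probability T R).
Variable alpha : nat -> {RV P >-> R}.
Hypothesis alpha_unif : forall j, uniform01 P (alpha j).
Hypothesis alpha_indep : mutually_independent P (fun j w => alpha j w).
Local Notation mu := (@lebesgue_measure R).
Local Notation F n := (natural_filtration (fun j w => alpha j w) n).

Definition orbit_value (z : R) (n : nat) (w : T) : R :=
  rank_orbit (fun j => alpha j w) n z.

Lemma measurable_rank_step : measurable_fun setT (fun x : R * R => rank_step x.2 x.1).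
Proof.
have m1 : measurable_fun setT (fun x : R * R => pi * x.1).
  by apply: measurable_funM => //; exact: measurable_fst.
have m2 : measurable_fun setT (fun x : R * R => 2 * pi * x.2).
  by apply: measurable_funM => //; exact: measurable_snd.
apply: measurable_funB; first exact: measurable_fst.
apply: measurable_funM.
  apply: measurable_funM => //.
  apply: measurableT_comp m1; apply: continuous_measurable_fun; exact: continuous_sin.
apply: (measurableT_comp (f := cos)).
  apply: continuous_measurable_fun; exact: continuous_cos.
exact: measurable_funD.
Qed.

Lemma continuous_sin_pi : continuous (fun x : R => sin (pi * x)).
Proof.
move=> x; apply: (@continuous_comp _ _ _ (fun u : R => pi * u)).
  by apply: cvgM; [exact: cvg_cst|exact: cvg_id].
exact: continuous_sin.
Qed.

Lemma measurable_sin_pi_sqr : measurable_fun setT (fun x : R => sin (pi * x) ^+ 2).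
Proof.
by apply: measurable_funX; apply: continuous_measurable_fun; exact: continuous_sin_pi.
Qed.

Section fixed_start.
Variable z : R.
Hypothesis z01 : 0 <= z <= 1.
Local Notation Z := (orbit_value z).

Lemma orbit_value_itv n w : 0 <= Z n w <= 1.
Proof. exact: rank_orbit_itv. Qed.

Lemma orbit_valueS n w : Z n.+1 w = rank_step (alpha n w) (Z n w).
Proof. exact: rank_orbitS. Qed.

Lemma filtration_meas_orbit n : filtration_meas alpha n (Z n).
Proof.
elim: n => [|n IH]; first exact: filtration_meas_cst.
have -> : Z n.+1 = (fun x : R * R => rank_step x.2 x.1) \o (fun w => (Z n w, alpha n w)).
  by apply/funext => w; rewrite orbit_valueS.
apply: filtration_meas_comp; last exact: measurable_rank_step.
by apply: filtration_meas_pair; [exact: filtration_measS|exact: filtration_meas_RV].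
Qed.

Lemma measurable_orbit n : measurable_fun setT (Z n).
Proof. exact: (filtration_meas_fun (@filtration_meas_orbit n)). Qed.

Local Open Scope ereal_scope.

Lemma Rintegral_EFin (h : R -> R) : continuous h ->
  \int[mu]_(u in `[0%R, 1%R]) (h u)%:E = (\int[mu]_(u in `[0%R, 1%R]) h u)%:E.
Proof.
move=> ch; rewrite /Rintegral fineK//.
exact/integrable_fin_num/continuous_integrable_itv.
Qed.

(** Freezing applied to the recursion: given the past, the next rank is
    [rank_step u (Z n w)] with u uniform. *)
Lemma orbit_step_integral n (A : set T) (g : R -> R -> R) (h : R -> R) :
  F n A -> measurable_fun setT (fun x : R * R => g x.1 x.2) ->
  (forall x y, (0 <= x <= 1 -> 0 <= y <= 1 -> 0 <= g x y)%R) ->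
  (forall x, (0 <= x <= 1)%R ->
     \int[mu]_(u in `[0%R, 1%R]) (g x (rank_step u x))%:E = (h x)%:E) ->
  \int[P]_(w in A) (g (Z n w) (Z n.+1 w))%:E = \int[P]_(w in A) (h (Z n w))%:E.
Proof.
move=> FA mg g0 gh.
(* The absolute value makes phi nonnegative off the unit square as well; it
   changes nothing on the orbit. *)
pose phi (x : R * R) := (`|g x.1 (rank_step x.2 x.1)|)%:E.
have mphi : measurable_fun setT phi.
  apply/measurable_EFinP; apply: measurableT_comp => //.
  apply: (measurableT_comp mg (g := fun x : R * R => (x.1, rank_step x.2 x.1))).
  by apply: measurable_fun_pair; [exact: measurable_fst|exact: measurable_rank_step].
have phi0 x : 0 <= phi x by rewrite lee_fin.
have gE x u : (0 <= x <= 1)%R -> phi (x, u) = (g x (rank_step u x))%:E.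
  by move=> x01; rewrite /phi/= ger0_norm// g0// rank_step_itv.
have := filtration_freezing_set alpha_indep alpha_unif FA (@filtration_meas_orbit n) mphi phi0.
under eq_integral do rewrite gE ?orbit_value_itv// -orbit_valueS.
move=> ->; apply: eq_integral => w _.
by under eq_integral do rewrite gE ?orbit_value_itv//; rewrite gh ?orbit_value_itv.
Qed.

Lemma orbit_martingale n (A : set T) : F n A ->
  \int[P]_(w in A) (Z n.+1 w)%:E = \int[P]_(w in A) (Z n w)%:E.
Proof.
move=> FA; apply: (orbit_step_integral (g := fun _ y => y) (h := id)) => //.
- exact: measurable_snd.
- by move=> x y _ /andP[].
- move=> x _; rewrite Rintegral_EFin ?Rintegral_rank_step//.
  exact: continuous_rank_step_param.
Qed.

Lemma orbit_sqr_increment n (A : set T) : F n A ->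
  \int[P]_(w in A) ((Z n.+1 w - Z n w) ^+ 2)%:E =
  \int[P]_(w in A) (sin (pi * Z n w) ^+ 2 / (2 * pi ^+ 2))%:E.
Proof.
move=> FA; apply: (orbit_step_integral (g := fun x y => ((y - x) ^+ 2)%R)
  (h := fun x => (sin (pi * x) ^+ 2 / (2 * pi ^+ 2))%R)) => //.
- apply: measurable_funX; apply: measurable_funB.
    exact: measurable_snd.
  exact: measurable_fst.
- by move=> x y _ _; rewrite sqr_ge0.
- move=> x _; rewrite Rintegral_EFin ?Rintegral_rank_step_sqr// => u.
  have h : {for u, continuous (fun u => rank_step u x - x)%R}.
    by apply: cvgB; [exact: continuous_rank_step_param|exact: cvg_cst].
  exact: (cvgM h h).
Qed.

Lemma filtration_setT n : F n setT.
Proof. by rewrite -(setC0); apply: (sigma_algebraC (G := _)); exact: sigma_algebra0. Qed.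

Lemma orbit_mean n : \int[P]_w (Z n w)%:E = z%:E.
Proof.
elim: n => [|n IH]; last by rewrite orbit_martingale//; exact: filtration_setT.
by rewrite /orbit_value /= integral_cst//= probability_setT mule1.
Qed.

(** Orthogonality of martingale increments: the mean of z_n^2 grows by the mean
    of the conditional variance. *)
Lemma orbit_sqr n : \int[P]_w (Z n.+1 w ^+ 2)%:E =
  \int[P]_w (Z n w ^+ 2)%:E +
  ((2 * pi ^+ 2)^-1)%:E * \int[P]_w (sin (pi * Z n w) ^+ 2)%:E.
Proof.
rewrite (orbit_step_integral (A := setT) (g := fun _ y => (y ^+ 2)%R)
  (h := fun x => (x ^+ 2 + (2 * pi ^+ 2)^-1 * sin (pi * x) ^+ 2)%R)).
- under eq_integral do rewrite EFinD.
  have ms : measurable_fun setT (fun w => sin (pi * Z n w) ^+ 2)%R.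
    exact: (measurableT_comp measurable_sin_pi_sqr (measurable_orbit n)).
  have q0 : (0 <= (2 * pi ^+ 2)^-1 :> R)%R by rewrite invr_ge0 mulr_ge0 ?sqr_ge0.
  rewrite ge0_integralD//; last 4 first.
  + by move=> w _; rewrite lee_fin sqr_ge0.
  + by apply/measurable_EFinP; apply: measurable_funX; exact: measurable_orbit.
  + by move=> w _; rewrite lee_fin mulr_ge0 ?sqr_ge0.
  + by apply/measurable_EFinP; exact: measurable_funM.
  under [X in _ + X = _]eq_integral do rewrite EFinM.
  rewrite ge0_integralZl_EFin//; first by move=> w _; rewrite lee_fin sqr_ge0.
  exact/measurable_EFinP.
- exact: filtration_setT.
- by apply: measurable_funX; exact: measurable_snd.
- by move=> x y _ _; rewrite sqr_ge0.
- move=> x _.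
  have c1 := @continuous_rank_step_param R x.
  have h : continuous (fun u => rank_step u x - x)%R.
    by move=> u; apply: cvgB; [exact: c1|exact: cvg_cst].
  have c2 : continuous (fun u => (rank_step u x - x) ^+ 2)%R by move=> u; exact: (cvgM (h u) (h u)).
  have c3 : continuous (fun u => 2 * x * (rank_step u x - x))%R.
    by move=> u; apply: cvgM; [exact: cvg_cst|exact: h].
  have c4 : continuous (fun u => (rank_step u x - x) ^+ 2 + 2 * x * (rank_step u x - x))%R.
    by move=> u; apply: cvgD; [exact: c2|exact: c3].
  have E u : (rank_step u x ^+ 2 = (rank_step u x - x) ^+ 2 + 2 * x * (rank_step u x - x) + x ^+ 2)%R.
    by ring.
  under eq_integral do rewrite E.
  rewrite Rintegral_EFin; last first.
    by move=> u; apply: cvgD; [exact: c4|exact: cvg_cst].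
  congr EFin; rewrite RintegralD//; [|exact: (continuous_integrable_itv _ _ c4)|
    apply: continuous_integrable_itv; exact: cst_continuous].
  rewrite RintegralD//; [|exact: (continuous_integrable_itv _ _ c2)|exact: (continuous_integrable_itv _ _ c3)].
  rewrite RintegralZl//; last exact: (continuous_integrable_itv _ _ h).
  rewrite RintegralB//; [|exact: (continuous_integrable_itv _ _ c1)|
    apply: continuous_integrable_itv; exact: cst_continuous].
  rewrite Rintegral_rank_step Rintegral_rank_step_sqr !Rintegral01_cst.
  by rewrite subrr mulr0 addr0 addrC mulrC.
Qed.

End fixed_start.
End orbit_moments.

(** * The limit of the rank orbit *)
Section orbit_limit.
Context (R : realType) d (T : measurableType d) (P : probability T R).

Lemma unit_bounded_cvg (f_ : nat -> T -> R) (f : T -> R) :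
  (forall n, measurable_fun setT (f_ n)) -> measurable_fun setT f ->
  (forall n w, 0 <= f_ n w <= 1) ->
  {ae P, forall w, f_ n w @[n --> \oo] --> f w} ->
  (\int[P]_w (f_ n w)%:E @[n --> \oo] --> \int[P]_w (f w)%:E)%E.
Proof.
move=> mf_ mf f01 ff.
have [|||||_ _] := @dominated_convergence _ _ _ P setT measurableT
    (fun n w => (f_ n w)%:E) (fun w => (f w)%:E) (cst 1%E).
- by move=> n; exact/measurable_EFinP.
- exact/measurable_EFinP.
- by apply: filterS ff => w h _; apply: cvg_EFin => //; exact: nearW.
- exact: finite_measure_integrable_cst.
- apply: aeW => w n _ /=; rewrite lee_fin; have := f01 n w.
  by rewrite ler_norml; lra.
exact.
Qed.

Variable alpha : nat -> {RV P >-> R}.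
Hypothesis alpha_unif : forall j, uniform01 P (alpha j).
Hypothesis alpha_indep : mutually_independent P (fun j w => alpha j w).

Variable z : R.
Hypothesis z01 : 0 <= z <= 1.
Local Notation Z := (orbit_value alpha z).

(** The upper limit is measurable and defined everywhere; the limit exists only
    almost surely. *)
Definition orbit_limit (w : T) : R := limn_sup (Z ^~ w).

Lemma measurable_orbit_limit : measurable_fun setT orbit_limit.
Proof.
apply: measurable_fun_limn_sup => [w _|w _|n].
- by exists 1 => _ [n _ <-]; have /andP[] := orbit_value_itv alpha z01 n w.
- by exists 0 => _ [n _ <-]; have /andP[] := orbit_value_itv alpha z01 n w.
- exact: measurable_orbit.
Qed.

Lemma measurable_sin_orbit n : measurable_fun setT (fun w => sin (pi * Z n w) ^+ 2).
Proof.
exact: (measurableT_comp (@measurable_sin_pi_sqr R) (measurable_orbit alpha z01 n)).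
Qed.

Lemma integral_unit_fin (f : T -> R) : measurable_fun setT f ->
  (forall w, 0 <= f w <= 1) ->
  exists2 r : R, 0 <= r <= 1 & (\int[P]_w (f w)%:E = r%:E)%E.
Proof.
move=> mf f01.
have h0 : (0 <= \int[P]_w (f w)%:E)%E.
  by apply: integral_ge0 => w _; rewrite lee_fin; have /andP[] := f01 w.
have h1 : (\int[P]_w (f w)%:E <= 1)%E.
  have <- : (\int[P]_w 1%:E = 1 :> \bar R)%E by rewrite integral_cst//= probability_setT mule1.
  apply: ge0_le_integral => //.
  - by move=> w _; rewrite lee_fin; have /andP[] := f01 w.
  - exact/measurable_EFinP.
  - by move=> w _; rewrite lee_fin; have /andP[] := f01 w.
move: h0 h1; case: (\int[P]_w (f w)%:E)%E => // r h0 h1.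
by exists r => //; rewrite -!lee_fin h0 h1.
Qed.

Lemma sin_sqr_unit (x : R) : 0 <= sin x ^+ 2 <= 1.
Proof. by rewrite sqr_ge0 /= sin2cos2 gerBl sqr_ge0. Qed.

Lemma orbit_sqr_unit n w : 0 <= Z n w ^+ 2 <= 1.
Proof. by have := orbit_value_itv alpha z01 n w; nra. Qed.

Lemma measurable_orbit_sqr n : measurable_fun setT (fun w => Z n w ^+ 2).
Proof. by apply: measurable_funX; exact: measurable_orbit. Qed.

(** The second moments telescope. *)
Lemma sum_sin_orbit N :
  (\sum_(0 <= n < N) \int[P]_w (sin (pi * Z n w) ^+ 2)%:E =
   (2 * pi ^+ 2)%:E * (\int[P]_w (Z N w ^+ 2)%:E - (z ^+ 2)%:E))%E.
Proof.
have pp : 2 * pi ^+ 2 != 0 :> R by rewrite mulf_neq0// expf_neq0// pi_neq0.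
elim: N => [|N IH].
  rewrite big_geq// /orbit_value /= integral_cst//= probability_setT mule1.
  by rewrite -EFinB subrr mule0.
rewrite big_nat_recr//= IH (orbit_sqr alpha_unif alpha_indep z01).
have [r _ ->] := integral_unit_fin (measurable_orbit_sqr N) (orbit_sqr_unit N).
have [s _ ->] := integral_unit_fin (measurable_sin_orbit N)
  (fun w => sin_sqr_unit (pi * Z N w)).
rewrite -!(EFinN, EFinM, EFinD); congr EFin.
by move: pp; move: (2 * pi ^+ 2) => q q0; field.
Qed.

(** The telescoped sum is bounded because ranks are in [0, 1], so sin (pi z_n)
    tends to 0 almost surely. *)
Lemma orbit_dichotomy_ae : {ae P, forall w,
  (Z n w @[n --> \oo] --> (0 : R)) \/ (Z n w @[n --> \oo] --> (1 : R))}.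
Proof.
have := @ae_cvg0_summable _ _ _ P (fun n w => sin (pi * Z n w) ^+ 2) (2 * pi ^+ 2).
move=> /(_ measurable_sin_orbit) /(_ (fun n w => sqr_ge0 _)).
have H N : (\sum_(0 <= n < N) \int[P]_w (sin (pi * Z n w) ^+ 2)%:E <= (2 * pi ^+ 2)%:E)%E.
  rewrite sum_sin_orbit.
  have [r r01 ->] := integral_unit_fin (measurable_orbit_sqr N) (orbit_sqr_unit N).
  rewrite -EFinB -EFinM lee_fin ler_piMr//; first by rewrite mulr_ge0 ?sqr_ge0.
  by have := sqr_ge0 z; lra.
move=> /(_ H); apply: filterS => w; exact: rank_orbit_dichotomy.
Qed.

Lemma orbit_limit_cvg : {ae P, forall w,
  Z n w @[n --> \oo] --> orbit_limit w /\ (orbit_limit w = 0 \/ orbit_limit w = 1)}.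
Proof.
apply: filterS orbit_dichotomy_ae => w h; rewrite /orbit_limit.
by case: h => h; rewrite (cvg_limn_inf_sup h); split=> //; [left|right].
Qed.

Lemma orbit_limit_mean : (\int[P]_w (orbit_limit w)%:E = z%:E)%E.
Proof.
have h := unit_bounded_cvg (measurable_orbit alpha z01) measurable_orbit_limit
  (orbit_value_itv alpha z01).
have /h {}h : {ae P, forall w, Z n w @[n --> \oo] --> orbit_limit w}.
  by apply: filterS orbit_limit_cvg => w [].
have h2 : (\int[P]_w (Z n w)%:E @[n --> \oo] --> z%:E)%E.
  by under eq_fun do rewrite (orbit_mean alpha_unif alpha_indep z01); exact: cvg_cst.
exact: (cvg_unique _ h h2).
Qed.

(** The limit is almost surely the indicator of the event that it equals 1, so
    its mean z is the probability of that event. *)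
Lemma orbit_limit_prob : P [set w | orbit_limit w = 1] = z%:E.
Proof.
have mE : measurable [set w | orbit_limit w = 1].
  have := measurable_orbit_limit measurableT (measurable_set1 (1 : R)).
  by rewrite setTI.
rewrite -(setIT [set w | _]) -integral_indic// -orbit_limit_mean.
apply: ae_eq_integral => //.
- by apply/measurable_EFinP; exact: measurable_indic.
- by apply/measurable_EFinP; exact: measurable_orbit_limit.
- apply: filterS orbit_limit_cvg => w [_ h] _; congr EFin.
  rewrite indicE; case: h => h.
    by rewrite memNset//= h => /esym/eqP; rewrite oner_eq0.
  by rewrite mem_set.
Qed.

(** The limit takes the values 0 and 1 only, so it equals its square, and the
    second moments tend to its mean z. *)
Lemma sum_sin_orbit_limit :
  (\sum_(0 <= n <oo) \int[P]_w (sin (pi * Z n w) ^+ 2)%:E =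
   (2 * pi ^+ 2 * (z * (1 - z)))%:E)%E.
Proof.
apply/cvg_lim => //; under eq_fun do rewrite sum_sin_orbit.
have h := unit_bounded_cvg measurable_orbit_sqr measurable_orbit_limit orbit_sqr_unit.
have /h {}h : {ae P, forall w, Z n w ^+ 2 @[n --> \oo] --> orbit_limit w}.
  apply: filterS orbit_limit_cvg => w [hw h01].
  have -> : orbit_limit w = orbit_limit w * orbit_limit w.
    by case: h01 => ->; rewrite ?mulr0 ?mulr1.
  exact: (cvgM hw hw).
rewrite orbit_limit_mean in h.
have -> : 2 * pi ^+ 2 * (z * (1 - z)) = 2 * pi ^+ 2 * (z - z ^+ 2) by ring.
rewrite EFinM EFinB; apply: cvgeZl => //; apply: cvgeB => //.
exact: cvg_cst.
Qed.

Lemma integrable_unit (f : T -> R) (K : R) : measurable_fun setT f ->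
  (forall w, `|f w| <= K) -> P.-integrable setT (EFin \o f).
Proof.
move=> mf fK; apply: measurable_bounded_integrable => //.
  by rewrite (le_lt_trans (probability_le1 P measurableT))// ltry.
by exists K; split; [exact: num_real|move=> x Kx w _; exact: le_trans (fK w) (ltW Kx)].
Qed.

Lemma orbit_cond_exp n :
  is_cond_exp P (natural_filtration (fun j w => alpha j w) n) (Z n.+1) (Z n).
Proof.
have b m w : `|Z m w| <= 1.
  by have := orbit_value_itv alpha z01 m w; rewrite ler_norml; lra.
split.
- exact: (integrable_unit (measurable_orbit alpha z01 n.+1) (b n.+1)).
- exact: (integrable_unit (measurable_orbit alpha z01 n) (b n)).
- exact: filtration_meas_orbit.
- by move=> A FA; rewrite (orbit_martingale alpha_unif alpha_indep z01).
Qed.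

(** The conditional mean is the current rank, by the martingale property. *)
Lemma orbit_cond_var n :
  is_cond_var P (natural_filtration (fun j w => alpha j w) n) (Z n.+1)
    (fun w => sin (pi * Z n w) ^+ 2 / (2 * pi ^+ 2)).
Proof.
exists (Z n); first exact: orbit_cond_exp.
have q0 : 0 <= (2 * pi ^+ 2)^-1 :> R by rewrite invr_ge0 mulr_ge0 ?sqr_ge0.
split.
- apply: (@integrable_unit _ 1).
    apply: measurable_funX; apply: measurable_funB; exact: measurable_orbit.
  move=> w; rewrite ger0_norm ?sqr_ge0//.
  by have := orbit_value_itv alpha z01 n w; have := orbit_value_itv alpha z01 n.+1 w; nra.
- apply: (@integrable_unit _ (2 * pi ^+ 2)^-1).
    by apply: measurable_funM => //; exact: measurable_sin_orbit.
  move=> w; have /andP[s0 s1] := sin_sqr_unit (pi * Z n w).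
  rewrite ger0_norm; last exact: mulr_ge0.
  exact: ler_piMl.
- apply: (@filtration_meas_comp _ _ _ _ _ _ _ _ _ _ (Z n)
    (fun x => sin (pi * x) ^+ 2 / (2 * pi ^+ 2))).
    exact: filtration_meas_orbit.
  by apply: measurable_funM => //; exact: measurable_sin_pi_sqr.
- by move=> A FA; rewrite (orbit_sqr_increment alpha_unif alpha_indep z01).
Qed.

End orbit_limit.

(** * Laws on the line determined by rays *)
Section ray_uniqueness.
Variable R : realType.
Local Open Scope ereal_scope.

(** Open rays are stable under intersection, generate the Borel sets and
    exhaust the line. *)
Lemma measure_eq_rays (m1 m2 : {measure set (measurableTypeR R) -> \bar R}) :
  (forall t : R, m1 `]-oo, t[%classic = m2 `]-oo, t[%classic) ->
  (forall t : R, m1 `]-oo, t[%classic < +oo) ->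
  forall B, measurable B -> m1 B = m2 B.
Proof.
move=> m12 m1oo B mB.
apply: (@measure_unique _ R (measurableTypeR R) (@RGenInftyO.G R)
  (fun n => `]-oo, (n%:R : R)[%classic)) => //.
- exact: RGenInftyO.measurableE.
- move=> _ _ [x ->] [y ->]; exists (Num.min x y).
  apply/seteqP; split=> t /=; rewrite !in_itv/= lt_min.
    by move=> [-> ->].
  by move=> /andP[].
- by move=> n; exists n%:R.
- apply/seteqP; split=> // t _; exists (Num.truncn t).+1 => //=.
  by rewrite in_itv /= truncnS_gt.
- by move=> _ [x ->].
Qed.

Lemma uniform_prob_ray (t : R) :
  uniform_prob (@ltr01 R) `]-oo, t[%classic = (Num.max 0 (Num.min 1 t))%R%:E.
Proof.
have mI : measurable (`]-oo, t[%classic : set R) by exact: measurable_itv.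
transitivity (\int[uniform_prob (@ltr01 R)]_x (\1_(`]-oo, t[%classic : set R) x)%:E).
  by rewrite integral_indic// setIT.
rewrite integral_uniform; last 2 first.
- by apply/measurable_EFinP; exact: measurable_indic.
- by move=> x; rewrite lee_fin.
rewrite subr0 invr1 mul1e integral_indic//.
have [t1|t1] := leP t 1%R.
  have -> : `]-oo, t[%classic `&` `[0%R, 1%R] = `[0%R, t[%classic :> set R.
    apply/seteqP; split=> x /=; rewrite !in_itv/=; first by move=> [-> /andP[->]].
    by move=> /andP[-> xt]; rewrite xt (ltW (lt_le_trans xt t1)).
  apply: (eq_trans (lebesgue_measure_itv `[0%R, t[)); rewrite /= lte_fin.
  have [t0|t0] := ltP 0%R t; rewrite ?sube0 ?max_r ?max_l//; exact: ltW.
have -> : `]-oo, t[%classic `&` `[0%R, 1%R] = `[0%R, 1%R]%classic :> set R.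
  apply/seteqP; split=> x /=; rewrite !in_itv/=; first by move=> [_ /andP[-> ->]].
  by move=> /andP[-> x1]; rewrite x1 (le_lt_trans x1 t1).
apply: (eq_trans (lebesgue_measure_itv `[0%R, 1%R])).
by rewrite /= lte_fin ltr01 sube0 max_r.
Qed.
End ray_uniqueness.

(** * The threshold between the two limits *)
Section threshold.
Context (R : realType) d (T : measurableType d) (P : probability T R).
Variable alpha : nat -> {RV P >-> R}.
Hypothesis alpha_unif : forall j, uniform01 P (alpha j).
Hypothesis alpha_indep : mutually_independent P (fun j w => alpha j w).

Lemma ae_le_measure (A B : set T) : measurable A -> measurable B ->
  {ae P, forall w, A w -> B w} -> (P A <= P B)%E.
Proof.
move=> mA mB [N [mN N0 sN]].
have AB : A `<=` B `|` N.
  move=> w Aw; have [Bw|nBw] := pselect (B w); first by left.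
  by right; apply: sN => /= h; exact/nBw/h.
apply: (@le_trans _ _ (P (B `|` N))).
  by apply: le_measure; rewrite ?inE//; exact: measurableU.
by apply: le_trans (measureU2 _ mB mN) _; rewrite [X in (_ + X)%E]N0 adde0.
Qed.

(** Rationals clamped to [0, 1], enumerated with repetitions; countability lets
    almost sure statements hold for all of them at once. *)
Definition rational01 (k : nat) : R :=
  Num.max 0 (Num.min 1 (ratr (odflt 0 (unpickle k : option rat)))).

Lemma rational01_itv k : 0 <= rational01 k <= 1.
Proof.
by rewrite /rational01 le_max lexx /= ge_max ler01 ge_min lexx.
Qed.

Lemma rational01_dense (x y : R) : 0 <= x -> x < y -> y <= 1 ->
  exists k, x < rational01 k < y.
Proof.
move=> x0 xy y1; have [q] := rat_in_itvoo xy; rewrite in_itv /= => /andP[xq qy].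
exists (pickle q); rewrite /rational01 pickleK /=.
rewrite min_r ?max_r ?xq ?qy//; [exact: ltW (le_lt_trans x0 xq)|exact/ltW/(lt_le_trans qy)].
Qed.

Local Notation S n w z := (rank_orbit (fun j => alpha j w) n z).

Definition threshold_candidate (k : nat) (w : T) : R :=
  rational01 k * \1_[set w | orbit_limit alpha (rational01 k) w = 0] w.

(** The supremum of the enumerated points whose orbit tends to 0. A point whose
    orbit does not tend to 0 contributes the value 0, which is harmless because
    the threshold is nonnegative. *)
Definition threshold (w : T) : R := sups (threshold_candidate ^~ w) 0.

Lemma threshold_candidate_itv k w : 0 <= threshold_candidate k w <= 1.
Proof.
have := rational01_itv k; rewrite /threshold_candidate indicE.
by case: (_ \in _); rewrite ?mulr1 ?mulr0 ?lexx ?ler01.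
Qed.

Lemma threshold_ub w : has_ubound (range (threshold_candidate ^~ w)).
Proof. by exists 1 => _ [k _ <-]; have /andP[] := threshold_candidate_itv k w. Qed.

Lemma threshold_candidate_le k w : threshold_candidate k w <= threshold w.
Proof.
apply: ub_le_sup; last by exists k.
by exists 1 => _ [j _ <-]; have /andP[] := threshold_candidate_itv j w.
Qed.

Lemma threshold_gt x w : x < threshold w -> exists k, x < threshold_candidate k w.
Proof.
move=> xt; have [|_ [k _ <-] xk] := sup_gt _ xt; last by exists k.
by exists (threshold_candidate 0 w), 0%N.
Qed.

Lemma threshold_itv w : 0 <= threshold w <= 1.
Proof.
apply/andP; split.
  by apply: le_trans (threshold_candidate_le 0 w); have /andP[] := threshold_candidate_itv 0 w.
apply: ge_sup; first by exists (threshold_candidate 0 w), 0%N.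
by move=> _ [j _ <-]; have /andP[] := threshold_candidate_itv j w.
Qed.

Lemma measurable_threshold : measurable_fun setT threshold.
Proof.
apply: (measurable_fun_sups (h := threshold_candidate)) => [w _|k].
  exact: threshold_ub.
apply: measurable_funM => //; apply: measurable_indic.
have := measurable_orbit_limit alpha (rational01_itv k) measurableT (measurable_set1 (0 : R)).
by rewrite setTI.
Qed.

(** S_n is nondecreasing, so an orbit started below an enumerated point that
    goes to 0 goes to 0, and an orbit started above one that goes to 1 goes
    to 1. *)
Lemma threshold_separates : {ae P, forall w, forall z, 0 <= z <= 1 ->
  (z < threshold w -> rank_orbit (fun j => alpha j w) n z @[n --> \oo] --> (0 : R)) /\
  (threshold w < z -> rank_orbit (fun j => alpha j w) n z @[n --> \oo] --> (1 : R))}.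
Proof.
have H k := orbit_limit_cvg alpha_unif alpha_indep (rational01_itv k).
apply: filterS (ae_foralln H) => w {}H z /andP[z0 z1]; split=> [zt|tz].
  have [k] := threshold_gt zt; rewrite /threshold_candidate indicE.
  have [] := boolP (_ \in _); last by rewrite mulr0 ltNge z0.
  rewrite inE/= mulr1 => l0 zk; have [+ _] := H k; rewrite l0 => h.
  apply: (squeeze_cvgr _ (cvg_cst 0) h); apply: nearW => n.
  have /andP[-> _] /= : 0 <= rank_orbit (fun j => alpha j w) n z <= 1.
    by apply: rank_orbit_itv; rewrite z0.
  by apply: rank_orbit_nd => //; [exact: ltW|have /andP[] := rational01_itv k].
have /andP[t0 _] := threshold_itv w.
have [k /andP[tk kz]] := rational01_dense t0 tz z1.
have k0 : 0 < rational01 k by exact: le_lt_trans tk.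
have [h [l0|l1]] := H k.
  have := threshold_candidate_le k w; rewrite /threshold_candidate indicE mem_set// mulr1.
  by rewrite leNgt tk.
rewrite l1 in h.
have h1 : (fun=> 1) @ \oo --> (1 : R) by exact: cvg_cst.
apply: (squeeze_cvgr _ h h1); apply: nearW => n.
have /andP[_ ->] /= : 0 <= rank_orbit (fun j => alpha j w) n z <= 1.
  by apply: rank_orbit_itv; rewrite z0.
by rewrite andbT; apply: rank_orbit_nd => //; exact: ltW.
Qed.

Lemma measurable_threshold_lt t : measurable [set w | threshold w < t].
Proof.
have -> : [set w | threshold w < t] = setT `&` threshold @^-1` `]-oo, t[.
  by rewrite setTI; apply/seteqP; split=> w; rewrite /= in_itv.
by apply: measurable_threshold => //; exact: measurable_itv.
Qed.

Lemma orbit_limit_threshold (t : R) : 0 <= t <= 1 ->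
  {ae P, forall w, (threshold w < t -> orbit_limit alpha t w = 1) /\
                   (t < threshold w -> orbit_limit alpha t w = 0)}.
Proof.
move=> t01; apply: filterS threshold_separates => w /(_ t t01)[h0 h1].
by split=> [/h1 h|/h0 h]; rewrite /orbit_limit (cvg_limn_inf_sup h).
Qed.

(** Up to null events, {tau < t} is contained in the event that the orbit of t
    tends to 1, of probability t, and contains the same event for t - e. *)
Lemma threshold_lt_prob t : 0 <= t <= 1 -> P [set w | threshold w < t] = t%:E.
Proof.
move=> t01; have mE s : 0 <= s <= 1 -> measurable [set w | orbit_limit alpha s w = 1].
  move=> s01; have := measurable_orbit_limit alpha s01 measurableT (measurable_set1 (1 : R)).
  by rewrite setTI.
apply/eqP; rewrite eq_le; apply/andP; split.
  rewrite -(orbit_limit_prob alpha_unif alpha_indep t01).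
  apply: ae_le_measure; [exact: measurable_threshold_lt|exact: mE|].
  by apply: filterS (orbit_limit_threshold t01) => w [].
apply/lee_addgt0Pr => e e0.
have [te|te] := ltP (t - e) 0.
  apply: (@le_trans _ _ (0 + e%:E)%E); first by rewrite add0e lee_fin; lra.
  by rewrite leeD2r.
have s01 : 0 <= t - e <= 1 by lra.
rewrite -leeBlDr// -EFinB -(orbit_limit_prob alpha_unif alpha_indep s01).
apply: ae_le_measure; [exact: mE|exact: measurable_threshold_lt|].
apply: filterS (orbit_limit_threshold s01) => w [_ h] /= l1.
rewrite ltNge; apply/negP => tt.
have /h : t - e < threshold w by lra.
by rewrite l1 => /eqP; rewrite oner_eq0.
Qed.

Definition threshold_RV : {RV P >-> R} :=
  HB.pack threshold (isMeasurableFun.Build _ _ _ _ _ measurable_threshold).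

Lemma threshold_uniform : uniform01 P threshold_RV.
Proof.
pose XG : T -> measurableTypeR R := threshold.
have mXG : measurable_fun setT XG by exact: measurable_threshold.
pose XGp : {mfun T >-> measurableTypeR R} :=
  HB.pack XG (isMeasurableFun.Build _ _ _ _ _ mXG).
move=> B mB; apply: (@measure_eq_rays R (distribution P XGp) (uniform_prob (@ltr01 R))) => //.
  move=> t; transitivity (P [set w | threshold w < t]).
    by congr (P _); apply/seteqP; split=> w; rewrite /= in_itv.
  apply: (eq_trans _ (esym (uniform_prob_ray t))).
  have [t0|t0] := ltP t 0.
    rewrite min_r ?max_l; [|lra|lra].
    rewrite (_ : [set w | _] = set0) ?measure0//.
    apply/seteqP; split=> // w /=; have := threshold_itv w; lra.
  have [t1|t1] := leP t 1.
    by rewrite max_r// threshold_lt_prob// t0.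
  rewrite max_r// (_ : [set w | _] = setT) ?probability_setT//.
  by apply/seteqP; split=> // w _ /=; have := threshold_itv w; lra.
move=> t; rewrite (le_lt_trans (probability_le1 _ _))// ?ltry//.
Qed.

End threshold.

(** * Measures with a density *)
Section density_measure.
Variable R : realType.
Local Notation mu := (@lebesgue_measure R).
Local Open Scope ereal_scope.

(** The proofs that f is measurable and nonnegative are arguments, so that the
    measure structure below can be inferred from the function alone. *)
Definition density_measure (f : R -> R) (mf : measurable_fun setT f)
    (f0 : forall x, (0 <= f x)%R) : set (measurableTypeR R) -> \bar R :=
  fun B => \int[mu]_(x in B) (f x)%:E.

Section instance.
Variables (f : R -> R) (mf : measurable_fun setT f) (f0 : forall x, (0 <= f x)%R).
Local Notation nu := (density_measure mf f0).

Let nu0 : nu set0 = 0. Proof. by rewrite /density_measure integral_set0. Qed.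

Let nu_ge0 B : 0 <= nu B.
Proof. by apply: integral_ge0 => x _; rewrite lee_fin. Qed.

Let nu_sigma_additive : semi_sigma_additive nu.
Proof.
move=> /= F mF tF mUF; rewrite /density_measure; apply: cvg_toP.
  apply: ereal_nondecreasing_is_cvgn => m n mn.
  apply: lee_sum_nneg_natr => // k _ _.
  by apply: integral_ge0 => /= x Fkx; rewrite lee_fin.
rewrite ge0_integral_bigcup//=.
- by apply: measurable_funTS; exact/measurable_EFinP.
- by move=> x _; rewrite lee_fin.
Qed.

HB.instance Definition _ := isMeasure.Build _ _ _ nu nu0 nu_ge0 nu_sigma_additive.

Import HBNNSimple.

Let integral_density_nnsfun (g : {nnsfun (measurableTypeR R) >-> R}) :
  \int[nu]_x (g x)%:E = \int[mu]_x ((g x)%:E * (f x)%:E).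
Proof.
under [LHS]eq_integral do rewrite fimfunE -fsumEFin//.
under [RHS]eq_integral.
  move=> x xD; rewrite fimfunE -fsumEFin// ge0_mule_fsuml; last first.
    by move=> r; rewrite EFinM nnfun_muleindic_ge0.
  over.
have mE r : measurable (g @^-1` [set r]) by [].
rewrite [LHS]ge0_integral_fsum//; last 2 first.
  - by move=> r; apply/measurable_EFinP; apply: measurable_funM => //; exact: measurable_indic.
  - by move=> n x _; rewrite EFinM nnfun_muleindic_ge0.
have mRHS r : measurable_fun setT (fun x => (r * \1_(g @^-1` [set r]) x)%:E * (f x)%:E).
  apply: emeasurable_funM; last exact/measurable_EFinP.
  by apply/measurable_EFinP; apply: measurable_funM => //; exact: measurable_indic.
rewrite [RHS]ge0_integral_fsum//; last first.
  by move=> r x _; rewrite mule_ge0 ?lee_fin// -lee_fin EFinM nnfun_muleindic_ge0.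
apply: eq_fsbigr => r _.
rewrite integralZl_indic_nnsfun//= integral_indic//= setIT.
have [r0|r0] := leP 0%R r; last first.
  have E : g @^-1` [set r] = set0.
    by apply/seteqP; split=> // x /= gx; move: r0; rewrite -gx ltNge fun_ge0.
  rewrite E measure0 mule0; under eq_integral do rewrite indic0 mulr0 mul0e.
  by rewrite integral0.
under eq_integral do rewrite EFinM -muleA.
rewrite ge0_integralZl//; last 2 first.
- apply: emeasurable_funM; last exact/measurable_EFinP.
  by apply/measurable_EFinP; exact: measurable_indic.
- by move=> x _; rewrite -EFinM lee_fin mulr_ge0.
congr (_ * _); rewrite /density_measure [LHS]integral_mkcond.
apply: eq_integral => x _; rewrite patchE indicE.
by case: ifPn => _; rewrite ?mul1e ?mul0e.
Qed.

(** Simple functions first, then monotone convergence. *)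
Lemma integral_density_measure (h : measurableTypeR R -> \bar R) :
  measurable_fun setT h -> (forall x, 0 <= h x) ->
  \int[nu]_x h x = \int[mu]_x (h x * (f x)%:E).
Proof.
move=> mh h0.
pose g_ := nnsfun_approx measurableT mh.
have g_h x : (g_ n x)%:E @[n --> \oo] --> h x.
  by apply: cvg_nnsfun_approx => // *; exact: h0.
transitivity (lim (\int[nu]_x (g_ n x)%:E @[n --> \oo])).
  rewrite -monotone_convergence//=.
  - by apply: eq_integral => x _; apply/esym/cvg_lim => //; exact: g_h.
  - move=> n; apply/measurable_EFinP. exact: measurable_funPT.
  - by move=> n ? _; rewrite lee_fin.
  - by move=> ? _ ? ? mn; rewrite lee_fin; exact/lefP/nd_nnsfun_approx.
transitivity (lim (\int[mu]_x ((g_ n x)%:E * (f x)%:E) @[n --> \oo])); last first.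
  rewrite -monotone_convergence//=.
  - apply: eq_integral => x _; apply/cvg_lim => //.
    by apply: cvgeZr => //; exact: g_h.
  - move=> n; apply: emeasurable_funM; last exact/measurable_EFinP.
    by apply/measurable_EFinP; exact: measurable_funPT.
  - by move=> n x _; rewrite -EFinM lee_fin mulr_ge0.
  - move=> x _ m n mn; rewrite -!EFinM lee_fin ler_wpM2r//.
    exact/lefP/nd_nnsfun_approx.
by apply: congr_lim; apply/funext => n; exact: integral_density_nnsfun.
Qed.
End instance.
End density_measure.

(** * Distribution functions of densities *)
Section distribution_function.
Variable R : realType.
Local Notation mu := (@lebesgue_measure R).
Variable g : R -> R.
Hypothesis pg : prob_density g.
Local Notation G := (distfun g).

Let mg : measurable_fun setT g. Proof. by case: pg. Qed.
Let g0 x : 0 <= g x. Proof. by case: pg. Qed.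
Let g1 : (\int[mu]_x (g x)%:E = 1)%E. Proof. by case: pg. Qed.
Local Notation nu := (density_measure mg g0).

Lemma density_integrable : mu.-integrable setT (EFin \o g).
Proof.
apply/integrableP; split; first exact/measurable_EFinP.
under eq_integral do rewrite /= ger0_norm//.
by rewrite g1 ltry.
Qed.

Lemma density_integrableS (A : set R) : measurable A -> mu.-integrable A (EFin \o g).
Proof. by move=> mA; exact: integrableS density_integrable. Qed.

Lemma distfunE x : (G x)%:E = (\int[mu]_(t in `]-oo, x]) (g t)%:E)%E.
Proof.
rewrite /distfun /Rintegral fineK//.
by apply: integrable_fin_num => //; apply: density_integrableS; exact: measurable_itv.
Qed.

Lemma density_measure_rayE x : nu `]-oo, x]%classic = (G x)%:E.
Proof. by rewrite distfunE. Qed.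

Lemma density_measure_rayoE x : nu `]-oo, x[%classic = (G x)%:E.
Proof.
rewrite distfunE /density_measure integral_itv_bndo_bndc//.
by apply/measurable_EFinP; exact: measurable_funTS.
Qed.

Lemma distfunB a b : a <= b -> G b - G a = \int[mu]_(x in `[a, b]) g x.
Proof.
move=> ab; rewrite /distfun Rintegral_itvB; last 3 first.
- by apply: density_integrableS; exact: measurable_itv.
- by rewrite bnd_simp.
- by rewrite bnd_simp.
by rewrite Rintegral_itv_obnd_cbnd//; apply: density_integrableS; exact: measurable_itv.
Qed.

Lemma distfun_nd a b : a <= b -> G a <= G b.
Proof.
by move=> ab; rewrite -subr_ge0 distfunB//; apply: Rintegral_ge0 => x _; exact: g0.
Qed.

Lemma distfun_ge0 x : 0 <= G x.
Proof. by apply: Rintegral_ge0 => t _; exact: g0. Qed.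

Lemma distfun_le1 x : G x <= 1.
Proof.
rewrite -lee_fin distfunE -g1; apply: ge0_subset_integral => //.
- by apply/measurable_EFinP.
- by move=> t _; rewrite lee_fin g0.
Qed.

Lemma continuous_distfun : continuous G.
Proof.
move=> x; have x11 : x - 1 < x + 1 by lra.
have /(continuous_within_itvP _ x11)[+ _ _] :
    {within `[x - 1, x + 1], continuous (fun y => \int[mu]_(t in `[x - 1, y]) g t)}.
  apply: parameterized_integral_continuous; first exact: ltW.
  by apply: density_integrableS; exact: measurable_itv.
have xin : x \in `]x - 1, x + 1[ by rewrite in_itv/=; lra.
move=> /(_ x xin) h.
have h2 : {for x, continuous (fun y => G (x - 1) + \int[mu]_(t in `[x - 1, y]) g t)}.
  by apply: cvgD; [exact: cvg_cst|exact: h].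
have E y : x - 1 <= y -> G (x - 1) + \int[mu]_(t in `[x - 1, y]) g t = G y.
  by move=> xy; rewrite -distfunB//; ring.
move: h2; rewrite /prop_for /continuous_at E; last lra.
apply: cvg_trans; apply: near_eq_cvg; near=> y; rewrite E//.
suff: x - 1 < y by exact: ltW.
by near: y; apply: lt_nbhsr; lra.
Unshelve. all: by end_near. Qed.

(** Continuity from below of the measure along ]-oo, n]. *)
Lemma distfun_gtP y : y < 1 -> exists b, y < G b.
Proof.
move=> y1; apply: contrapT => /forallNP h.
have hG b : G b <= y by rewrite leNgt; apply/negP/h.
pose F (n : nat) := (`]-oo, n%:R]%classic : set (measurableTypeR R)).
have FE : nu (\bigcup_n F n) = 1%E.
  rewrite -g1 /density_measure; congr (integral _ _ _).
  apply/seteqP; split=> // t _; exists (Num.truncn t).+1 => //=.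
  by rewrite /F /= in_itv /= ltW// truncnS_gt.
have nd : nondecreasing_seq F.
  move=> m n mn; apply/subsetPset => t /=; rewrite /F /= !in_itv/= => tm.
  by apply: le_trans tm _; rewrite ler_nat.
have mI n : measurable (F n) by exact: (@measurable_itv R).
have cv : nu \o F @ \oo --> 1%E.
  by rewrite -FE; apply: nondecreasing_cvg_mu => //; exact: bigcupT_measurable.
have : (1 <= y%:E)%E.
  rewrite -(cvg_lim (@ereal_hausdorff R) cv); apply: lime_le; first by apply/cvg_ex; exists 1%E.
  by apply: nearW => n /=; rewrite density_measure_rayE lee_fin.
by rewrite lee_fin leNgt y1.
Qed.

(** Continuity from above of the measure along ]-oo, -n]. *)
Lemma distfun_ltP y : 0 < y -> exists a, G a < y.
Proof.
move=> y0; apply: contrapT => /forallNP h.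
have hG b : y <= G b by rewrite leNgt; apply/negP/h.
pose F (n : nat) := (`]-oo, - n%:R]%classic : set (measurableTypeR R)).
have F0 : nu (\bigcap_n F n) = 0%E.
  rewrite (_ : \bigcap_n _ = set0) ?measure0//.
  apply/seteqP; split=> // t /(_ (Num.truncn (- t)).+1 I) /=.
  by rewrite /F /= in_itv /= lerNr leNgt truncnS_gt.
have nd : nonincreasing_seq F.
  move=> m n mn; apply/subsetPset => t /=; rewrite /F /= !in_itv/= => tm.
  by apply: le_trans tm _; rewrite lerN2 ler_nat.
have mI n : measurable (F n) by exact: (@measurable_itv R).
have Foo : (nu (F 0%N) < +oo)%E by rewrite density_measure_rayE ltry.
have cv : nu \o F @ \oo --> 0%E.
  by rewrite -F0; apply: nonincreasing_cvg_mu => //; exact: bigcap_measurableType.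
have : (y%:E <= 0)%E.
  rewrite -(cvg_lim (@ereal_hausdorff R) cv); apply: lime_ge; first by apply/cvg_ex; exists 0%E.
  by apply: nearW => n /=; rewrite density_measure_rayE lee_fin.
by rewrite lee_fin leNgt y0.
Qed.

Lemma distfun_onto y : 0 < y < 1 -> exists x, G x = y.
Proof.
move=> /andP[y0 y1]; have [a ay] := distfun_ltP y0; have [b yb] := distfun_gtP y1.
have ab : a <= b.
  by rewrite leNgt; apply/negP => /ltW /distfun_nd; rewrite leNgt (lt_trans ay yb).
have [||c _ <-] := @IVT _ G a b y ab.
- exact/continuous_subspaceT/continuous_distfun.
- by rewrite ge_min le_max (ltW ay) (ltW yb) orbT.
by exists c.
Qed.

Lemma measurable_distfun : measurable_fun setT G.
Proof. by apply: continuous_measurable_fun; exact: continuous_distfun. Qed.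

(** The probability integral transform: the image under G of the measure g dx
    restricted to a down-set of mass m is Lebesgue measure on [0, m]. This is a
    change of variables that needs no regularity of g. *)
Lemma distfun_pushforward (D : set R) (m : R) (w : R -> R) :
  measurable D -> (forall x y, D y -> x <= y -> D x) ->
  (\int[mu]_(x in D) (g x)%:E = m%:E)%E ->
  measurable_fun setT w -> (forall x, 0 <= w x) ->
  (\int[mu]_(x in D) (w (G x) * g x)%:E = \int[mu]_(y in `[0%R, m]) (w y)%:E)%E.
Proof.
move=> mD dD Dm mw w0.
pose gD x := g x * \1_D x.
have mgD : measurable_fun setT gD by apply: measurable_funM => //; exact: measurable_indic.
have gD0 x : 0 <= gD x by rewrite mulr_ge0.
pose l x : R := \1_(`[0, m]%classic : set R) x.
have ml : measurable_fun setT l by apply: measurable_indic; exact: measurable_itv.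
have l0 x : 0 <= l x by [].
pose GG : measurableTypeR R -> measurableTypeR R := G.
have mGG : measurable_fun setT GG by exact: measurable_distfun.
pose GGp : {mfun (measurableTypeR R) >-> (measurableTypeR R)} :=
  HB.pack GG (isMeasurableFun.Build _ _ _ _ _ mGG).
pose W : measurableTypeR R -> \bar R := fun y => (w y)%:E.
have mW : measurable_fun setT W by apply/measurable_EFinP; exact: mw.
have W0 y : (0 <= W y)%E by rewrite lee_fin.
have mDE (A : set R) : measurable A ->
    (\int[mu]_(x in A) (gD x)%:E = \int[mu]_(x in A `&` D) (g x)%:E)%E.
  move=> mA; rewrite integral_mkcondr; apply: eq_integral => x _.
  by rewrite patchE /gD indicE; case: ifPn => xD; rewrite ?mulr1 ?mulr0.
(* A point at which G takes a value below m lies in D, because otherwise D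
   would be contained in the ray that ends there. *)
have gE x y : y < m -> 0 < y -> G x = y -> D x.
  move=> ym y0 Gx; apply: contrapT => nDx; move: ym.
  rewrite -Gx -lte_fin distfunE -Dm ltNge => /negP; apply.
  apply: ge0_subset_integral => //.
  - by apply/measurable_EFinP; exact: measurable_funTS.
  - by move=> t _; rewrite lee_fin.
  - move=> t Dt; rewrite /= in_itv /= leNgt; apply/negP => xt.
    by apply: nDx; apply: dD Dt _; exact: ltW.
have m0 : 0 <= m by rewrite -lee_fin -Dm; apply: integral_ge0 => t _; rewrite lee_fin.
have m1 : m <= 1.
  rewrite -lee_fin -Dm -g1; apply: ge0_subset_integral => //.
  - exact/measurable_EFinP.
  - by move=> t _; rewrite lee_fin.
have mray t : measurable (G @^-1` `]-oo, t[ `&` D).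
  apply: measurableI => //; rewrite -[X in measurable X]setTI.
  by apply: measurable_distfun => //; exact: measurable_itv.
(* The two measures agree on rays: the mass of {G < t} in D is m or t,
   whichever is smaller. The lower bound uses points where G takes the value
   min m t - e. *)
have ray t : (\int[mu]_(x in G @^-1` `]-oo, t[ `&` D) (g x)%:E =
    (Num.max 0 (Num.min m t))%:E)%E.
  have [t0|t0] := leP t 0.
    rewrite max_l; last by rewrite ge_min t0 orbT.
    rewrite (_ : _ `&` _ = set0) ?integral_set0//.
    apply/seteqP; split=> // x [/=]; rewrite in_itv /= => Gt _.
    by have := distfun_ge0 x; lra.
  rewrite max_r; last by rewrite le_min m0 ltW.
  apply/eqP; rewrite eq_le; apply/andP; split.
    have [mt|tm] := leP m t.
      rewrite -Dm; apply: ge0_subset_integral => //.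
      - exact: mray.
      - by apply/measurable_EFinP; exact: measurable_funTS.
      - by move=> x _; rewrite lee_fin.
    have [|x Gx] := @distfun_onto t; first by rewrite t0 (lt_le_trans tm m1).
    rewrite -Gx distfunE; apply: ge0_subset_integral => //.
    - by rewrite Gx; exact: mray.
    - by apply/measurable_EFinP; exact: measurable_funTS.
    - by move=> y _; rewrite lee_fin.
    - move=> y [/=]; rewrite !in_itv /= => Gy _; rewrite leNgt; apply/negP => xy.
      by have := distfun_nd (ltW xy); lra.
  apply/lee_addgt0Pr => e e0.
  set r := Num.min m t.
  have rm : r <= m by rewrite ge_min lexx.
  have rt : r <= t by rewrite ge_min lexx orbT.
  have [re|re] := leP (r - e) 0.
    apply: (@le_trans _ _ (0 + e%:E)%E); first by rewrite add0e lee_fin; lra.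
    by rewrite leeD2r//; apply: integral_ge0 => y _; rewrite lee_fin.
  have [|x Gx] := @distfun_onto (r - e); first by rewrite re; lra.
  have Dx : D x by apply: (gE _ _ _ _ Gx); lra.
  rewrite -leeBlDr// -EFinB -Gx distfunE; apply: ge0_subset_integral => //.
  - exact: mray.
  - by apply/measurable_EFinP; exact: measurable_funTS.
  - by move=> y _; rewrite lee_fin.
  - move=> y /=; rewrite !in_itv /= => yx; split; last exact: dD Dx yx.
    by have := distfun_nd yx; lra.
have P1 t : pushforward (density_measure mgD gD0) GGp `]-oo, t[%classic =
    (Num.max 0 (Num.min m t))%:E.
  rewrite -ray; apply: mDE; rewrite -[X in measurable X]setTI.
  by apply: measurable_distfun => //; exact: measurable_itv.
have P2 t : density_measure ml l0 `]-oo, t[%classic =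
    (Num.max 0 (Num.min m t))%:E.
  transitivity (mu (`[0, m]%classic `&` `]-oo, t[%classic)).
    by apply: integral_indic; exact: measurable_itv.
  have [mt|tm] := ltP m t.
    rewrite max_r// (_ : _ `&` _ = `[0, m]%classic).
      rewrite lebesgue_measure_itv/= lte_fin; have [h|h] := ltP 0 m; rewrite ?sube0//.
      by congr EFin; lra.
    apply/seteqP; split=> y /=; rewrite !in_itv/=; first by case.
    by move=> /andP[y0 ym]; rewrite y0 ym; split=> //; lra.
  rewrite (_ : _ `&` _ = `[0, t[%classic).
    rewrite lebesgue_measure_itv/= lte_fin; have [h|h] := ltP 0 t; rewrite ?sube0//.
  apply/seteqP; split=> y /=; rewrite !in_itv/=; first by move=> [/andP[-> _] ->].
  by move=> /andP[y0 ym]; rewrite y0 ym; split=> //; lra.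
have key B : measurable B -> pushforward (density_measure mgD gD0) GGp B =
    density_measure ml l0 B.
  apply: measure_eq_rays => t; first exact: (eq_trans (P1 t) (esym (P2 t))).
  by apply: (le_lt_trans _ (ltry (Num.max 0 (Num.min m t)))); rewrite -P1.
transitivity (\int[density_measure mgD gD0]_x (W (GG x)))%E.
  rewrite integral_density_measure//; last exact: measurableT_comp.
  rewrite integral_mkcond; apply: eq_integral => x _.
  rewrite patchE /W /gD indicE; case: ifPn => xD.
    by rewrite mulr1.
  by rewrite mulr0 mule0.
transitivity (\int[pushforward (density_measure mgD gD0) GGp]_y W y)%E.
  by rewrite [RHS]ge0_integral_pushforward.
transitivity (\int[density_measure ml l0]_x (W x))%E.
  by apply: eq_measure_integral => B mB _; exact: key.
rewrite integral_density_measure// [RHS]integral_mkcond; apply: eq_integral => x _.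
rewrite patchE /W /l indicE; case: ifPn => xD.
  by rewrite mule1.
by rewrite mule0.
Qed.

End distribution_function.

(** * Orbits of densities *)
Section density_orbit_facts.
Variable R : realType.
Local Notation mu := (@lebesgue_measure R).

Lemma distfun_lt (g : R -> R) (x : R) : prob_density g ->
  {for x, continuous g} -> 0 < g x ->
  (forall a, a < x -> distfun g a < distfun g x) /\
  (forall b, x < b -> distfun g x < distfun g b).
Proof.
move=> pg cg gx; have [mg g0 _] := pg.
have g2 : 0 < g x / 2 by lra.
have [dl /= dl0 Hd] : \forall y \near x, `|g x - g y| < g x / 2.
  by move/cvgrPdist_lt : cg; apply.
have {}Hd y : `|x - y| < dl -> g x / 2 <= g y.
  by move=> /Hd /=; rewrite ltr_distl; lra.
have inc u v : u < v -> x - dl < u -> v < x + dl -> distfun g u < distfun g v.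
  move=> uv xu vx; rewrite -subr_gt0 (distfunB pg (ltW uv)).
  apply: (@lt_le_trans _ _ (\int[mu]_(t in `[u, v]) (g x / 2))).
    rewrite Rintegral_cst//= lebesgue_measure_itv/= lte_fin uv -EFinB /=.
    by rewrite mulr_gt0// subr_gt0.
  apply: le_Rintegral => //.
  - by apply: continuous_integrable_itv; exact: cst_continuous.
  - exact: (density_integrableS pg).
  - move=> t; rewrite /= in_itv/= => /andP[ut tv]; apply: Hd.
    by rewrite ltr_distl; lra.
split=> [a ax|b xb].
  apply: (@le_lt_trans _ _ (distfun g (Num.max a (x - dl / 2)))).
    by apply: distfun_nd => //; rewrite le_max lexx.
  apply: inc; [rewrite gt_max|rewrite lt_max|]; lra.
apply: (@lt_le_trans _ _ (distfun g (Num.min b (x + dl / 2)))).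
  apply: inc; [rewrite lt_min|lra|rewrite gt_min]; lra.
by apply: distfun_nd => //; rewrite ge_min lexx.
Qed.

Lemma continuous_sin2_weight_meas (a : R) : measurable_fun setT (sin2_weight a).
Proof. by apply: continuous_measurable_fun; exact: continuous_sin2_weight. Qed.

Lemma rank_map_integral (a z : R) :
  (\int[mu]_(s in `[0%R, z]) (sin2_weight a s)%:E = (rank_map a z)%:E)%E.
Proof.
rewrite /rank_map /Rintegral fineK//; apply: integrable_fin_num => //.
by apply: continuous_integrable_itv; exact: continuous_sin2_weight.
Qed.

(** The transform applied to the weight, on the whole line for the total mass
    and on a ray for the distribution function. *)
Lemma reweight_distfun (a : R) (g : R -> R) : prob_density g ->
  prob_density (reweight (sin2_weight a) g) /\
  forall x, distfun (reweight (sin2_weight a) g) x = rank_map a (distfun g x).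
Proof.
move=> pg; have [mg g0 g1] := pg.
have push D m := @distfun_pushforward _ _ pg D m (sin2_weight a).
split=> [|x].
  split.
  - apply: measurable_funM => //.
    exact: (measurableT_comp (@continuous_sin2_weight_meas a) (measurable_distfun pg)).
  - by move=> x; rewrite mulr_ge0// sin2_weight_ge0.
  - rewrite (push setT 1)//; [|exact: continuous_sin2_weight_meas|exact: sin2_weight_ge0].
    by rewrite rank_map_integral rank_mapE// rank_step1.
apply: EFin_inj; rewrite -rank_map_integral.
rewrite -(push `]-oo, x]%classic)//; last 4 first.
- by move=> s t /=; rewrite !in_itv/= => tx st; exact: le_trans tx.
- by rewrite -distfunE.
- exact: continuous_sin2_weight_meas.
- exact: sin2_weight_ge0.
rewrite /distfun /Rintegral fineK// -/(distfun g).
rewrite (push `]-oo, x]%classic (distfun g x))//; last 4 first.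
- by move=> s t /=; rewrite !in_itv/= => tx st; exact: le_trans tx.
- by rewrite -distfunE.
- exact: continuous_sin2_weight_meas.
- exact: sin2_weight_ge0.
by rewrite rank_map_integral.
Qed.

Lemma density_orbit_distfun (a : nat -> R) (f : R -> R) n : prob_density f ->
  prob_density (density_orbit a f n) /\
  forall x, distfun (density_orbit a f n) x = rank_orbit a n (distfun f x).
Proof.
move=> pf; elim: n => //= n [pn IH]; have [p1 E] := reweight_distfun (a n) pn.
by split=> // x; rewrite E IH.
Qed.

Section Dplus_facts.
Variable f : R -> R.
Hypothesis Df : Dplus f.
Let pf : prob_density f. Proof. by case: Df. Qed.

Lemma Dplus_gt0_continuous x : 0 < f x -> {for x, continuous f}.
Proof.
case: Df => _ [I [_ _ cI _ I0]] fx; apply: cI; apply: contrapT => /I0 fx0.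
by rewrite fx0 ltxx in fx.
Qed.

Lemma Dplus_distfun_lt x : 0 < f x ->
  (forall a, a < x -> distfun f a < distfun f x) /\
  (forall b, x < b -> distfun f x < distfun f b).
Proof. by move=> fx; apply: distfun_lt => //; exact: Dplus_gt0_continuous. Qed.

Lemma Dplus_distfun_itv x : 0 < f x -> 0 < distfun f x < 1.
Proof.
move=> fx; have [lo hi] := Dplus_distfun_lt fx; apply/andP; split.
  by apply: le_lt_trans (lo (x - 1) _); [exact: distfun_ge0|lra].
by apply: lt_le_trans (hi (x + 1) _) _; [lra|exact: distfun_le1].
Qed.

Lemma is_derive_rank_map (a z : R) : 0 < z ->
  is_derive z 1 (rank_map a) (sin2_weight a z).
Proof.
move=> z0; apply: near_eq_is_derive (is_derive_rank_step a z).
near=> y; rewrite rank_mapE//.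
suff: 0 < y by exact: ltW.
by near: y; exact: lt_nbhsr.
Unshelve. all: by end_near. Qed.

(** Chain rule along the recursion where f is positive, since there F takes its
    values in ]0, 1[, where the rank maps are differentiable; elsewhere both
    sides vanish. *)
Lemma density_orbit_derive (a : nat -> R) n x :
  density_orbit a f n x = derive1 (rank_orbit a n) (distfun f x) * f x.
Proof.
have [fx|fx] := ltP 0 (f x); last first.
  have fx0 : f x = 0 by apply/eqP; rewrite eq_le fx; case: pf => _ ->.
  by rewrite fx0 mulr0; elim: n => //= n IH; rewrite /reweight IH mulr0.
have F01 := Dplus_distfun_itv fx.
suff [df dfE ->] : exists2 df, is_derive (distfun f x) 1 (rank_orbit a n) df &
    density_orbit a f n x = df * f x.
  by rewrite derive1E (@derive_val _ _ _ _ _ _ _ dfE).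
elim: n => [|n [df dfE IH]] /=.
  by exists 1; [exact: is_derive_id|rewrite mul1r].
have [_ E] := density_orbit_distfun a n pf.
exists (sin2_weight (a n) (rank_orbit a n (distfun f x)) * df).
  apply: is_derive1_comp => //; apply: is_derive_rank_map.
  by have /andP[] := rank_orbit_itv_oo a n F01.
by rewrite /reweight E IH mulrA.
Qed.

(** F takes every value t in ]0, 1[. Such a value cannot be taken off the
    interval of positivity, for F is 0 to the left of it and 1 to the right. *)
Lemma quantileK t : 0 < t < 1 ->
  distfun f (quantile f t) = t /\ 0 < f (quantile f t).
Proof.
move=> t01; have [x Fx] := distfun_onto pf t01.
have fx : 0 < f x.
  case: Df => _ [I [_ iI cI I0 If0]]; rewrite ltNge; apply/negP => fx.
  have nIx : ~ I x by move=> /I0; rewrite ltNge fx.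
  have [lo|lo] := pselect (exists2 y, I y & y < x); last first.
    have : distfun f x = 0.
      rewrite /distfun; transitivity (\int[mu]_(t in `]-oo, x]) (0 : R)).
        apply: eq_Rintegral => y; rewrite inE/= in_itv/= => yx; apply: If0 => Iy.
        move: yx; rewrite le_eqVlt => /predU1P[yx|yx]; first by rewrite yx in Iy.
        by apply: lo; exists y.
      by rewrite Rintegral_cst ?mul0r.
    lra.
  have [y0 Iy0 y0x] := lo.
  have : distfun f x = 1.
    apply: EFin_inj; rewrite distfunE//; case: (pf) => mf f0 <-.
    rewrite integral_mkcond; apply: eq_integral => y _; rewrite patchE.
    case: ifPn => //; rewrite notin_setE/= in_itv/= => /negP; rewrite -ltNge => xy.
    rewrite If0// => Iy; apply: nIx; apply: (iI _ _ Iy0 Iy).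
    by rewrite (ltW y0x) (ltW xy).
  lra.
pose A := [set x | 0 < f x].
have tA : t \in distfun f @` A by rewrite inE; exists x.
split; first exact: pinvK.
have := @surjpinv_image_sub _ _ (fun=> 0) A (distfun f @` A) (distfun f).
apply; last by exists t => //; exact: set_mem.
by move=> y yA.
Qed.

End Dplus_facts.
End density_orbit_facts.

(** * Weak convergence to a point mass *)
Section weak_convergence.
Variable R : realType.
Local Notation mu := (@lebesgue_measure R).

Lemma density_ray_complement (g : R -> R) (x : R) : prob_density g ->
  (\int[mu]_(t in `]x, +oo[) (g t)%:E = (1 - distfun g x)%:E)%E.
Proof.
move=> pg; have [mg g0 g1] := pg.
have : (\int[mu]_(t in `]-oo, x]%classic `|` `]x, +oo[%classic) (g t)%:E = 1)%E.
  by rewrite -g1; congr (integral _ _ _); rewrite -setCitvl setUv.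
rewrite ge0_integral_setU//=; last 3 first.
- by apply/measurable_EFinP; exact: measurable_funTS.
- by move=> t _; rewrite lee_fin.
- by rewrite -setCitvl; apply/disj_setPCl.
rewrite -distfunE// => /(congr1 (fun y => y - (distfun g x)%:E)%E).
by rewrite addeAC subee// add0e => ->; rewrite EFinB.
Qed.

(** Split the line at c - dl/2 and c + dl/2: on the middle part phi is close to
    phi c, and the two tails have masses G_n (c - dl/2) and
    1 - G_n (c + dl/2), which tend to 0, while phi is bounded. *)
Lemma cvg_weakly_to_dirac_distfun (g : nat -> R -> R) (c : R) :
  (forall n, prob_density (g n)) ->
  (forall x, x < c -> distfun (g n) x @[n --> \oo] --> (0 : R)) ->
  (forall x, c < x -> distfun (g n) x @[n --> \oo] --> (1 : R)) ->
  cvg_weakly_to_dirac g c.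
Proof.
move=> pg glo ghi phi cphi bphi.
have [M M0 phiM] : exists2 M, 0 < M & forall x, `|phi x| <= M.
  move: bphi => [M [_ hM]]; exists (Num.max 1 (M + 1)).
    by rewrite lt_max ltr01.
  by move=> x; apply: hM => //; rewrite lt_max ltrDl ltr01 orbT.
have mphi : measurable_fun setT phi by exact: continuous_measurable_fun.
have iphig n : mu.-integrable setT (fun x => (phi x * g n x)%:E).
  apply: (le_integrable measurableT _ _ (integrableZl measurableT M (density_integrable (pg n)))).
    by apply/measurable_EFinP; apply: measurable_funM => //; case: (pg n).
  move=> x _ /=; have [_ g0 _] := pg n.
  by rewrite lee_fin normrM [leRHS]ger0_norm ?mulr_ge0 ?(ltW M0)// (ger0_norm (g0 x)) ler_wpM2r.
pose r n := \int[mu]_x (phi x * g n x).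
have rE n : (\int[mu]_x (phi x * g n x)%:E = (r n)%:E)%E.
  by rewrite /r /Rintegral fineK//; exact: integrable_fin_num.
suff rc : r n @[n --> \oo] --> phi c.
  by under eq_fun do rewrite rE; apply: cvg_EFin => //; exact: nearW.
apply/cvgrPdist_le => e e0.
have e2 : 0 < e / 2 by lra.
have [dl /= dl0 Hd] : \forall y \near c, `|phi c - phi y| < e / 2.
  by move/cvgrPdist_lt : (cphi c); apply.
pose a := c - dl / 2; pose b := c + dl / 2.
have near_c y : a < y -> y <= b -> `|phi y - phi c| <= e / 2.
  by move=> ay yb; rewrite distrC; apply: ltW; apply: Hd; rewrite /= ltr_distl /a /b in ay yb *; lra.
have bound n : `|phi c - r n| <= e / 2 + 2 * M * (distfun (g n) a + (1 - distfun (g n) b)).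
  have [mg g0 g1] := pg n.
  have gi := density_integrable (pg n).
  pose I1 x : R := \1_(`]-oo, a]%classic : set R) x.
  pose I2 x : R := \1_(`]b, +oo[%classic : set R) x.
  have Igr : phi c = \int[mu]_x (phi c * g n x).
    by rewrite RintegralZl// /Rintegral g1 mulr1.
  have icg : mu.-integrable setT (EFin \o (fun x => phi c * g n x)).
    exact: (integrableZl measurableT (phi c) gi).
  rewrite {1}Igr /r -RintegralB//; last exact: (iphig n).
  have mI1 : measurable_fun setT I1 by apply: measurable_indic; exact: measurable_itv.
  have mI2 : measurable_fun setT I2 by apply: measurable_indic; exact: measurable_itv.
  have I1E : (\int[mu]_x (I1 x * g n x)%:E = (distfun (g n) a)%:E)%E.
    rewrite distfunE// [RHS]integral_mkcond; apply: eq_integral => x _.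
    by rewrite patchE /I1 indicE; case: ifPn => _; rewrite ?mul1r ?mul0r.
  have I2E : (\int[mu]_x (I2 x * g n x)%:E = (1 - distfun (g n) b)%:E)%E.
    rewrite -density_ray_complement// [RHS]integral_mkcond; apply: eq_integral => x _.
    by rewrite patchE /I2 indicE; case: ifPn => _; rewrite ?mul1r ?mul0r.
  have idiff : mu.-integrable setT (EFin \o (fun x => phi c * g n x - phi x * g n x)).
    exact: (integrableB measurableT icg (iphig n)).
  apply: le_trans (le_normr_Rintegral measurableT idiff) _.
  rewrite -lee_fin.
  have -> : ((\int[mu]_t `|phi c * g n t - phi t * g n t|)%:E =
      \int[mu]_t (`|phi c * g n t - phi t * g n t|)%:E)%E.
    by rewrite /Rintegral fineK//; apply: integrable_fin_num => //; exact: (integrable_norm idiff).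
  pose u x := e / 2 * g n x; pose v1 x := 2 * M * (I1 x * g n x).
  pose v2 x := 2 * M * (I2 x * g n x).
  have M2 : 0 <= 2 * M by lra.
  have I10 x : 0 <= I1 x by [].
  have I20 x : 0 <= I2 x by [].
  have mI1g : measurable_fun setT (fun x => I1 x * g n x) by exact: measurable_funM.
  have mI2g : measurable_fun setT (fun x => I2 x * g n x) by exact: measurable_funM.
  have mu_ : measurable_fun setT (fun x => (u x)%:E).
    by apply/measurable_EFinP; exact: measurable_funM.
  have mv1 : measurable_fun setT (fun x => (v1 x)%:E).
    by apply/measurable_EFinP; exact: measurable_funM.
  have mv2 : measurable_fun setT (fun x => (v2 x)%:E).
    by apply/measurable_EFinP; exact: measurable_funM.
  have u0 x : setT x -> (0 <= (u x)%:E)%E by rewrite lee_fin mulr_ge0// ltW.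
  have v10 x : setT x -> (0 <= (v1 x)%:E)%E by rewrite lee_fin /v1 /v2 => _; apply: mulr_ge0 => //; exact: mulr_ge0.
  have v20 x : setT x -> (0 <= (v2 x)%:E)%E by rewrite lee_fin /v1 /v2 => _; apply: mulr_ge0 => //; exact: mulr_ge0.
  have v120 x : setT x -> (0 <= (v1 x)%:E + (v2 x)%:E)%E.
    by move=> xT; rewrite adde_ge0 ?v10 ?v20.
  have uv0 x : setT x -> (0 <= (u x)%:E + ((v1 x)%:E + (v2 x)%:E))%E.
    by move=> xT; rewrite adde_ge0 ?u0 ?v120.
  have mv12 : measurable_fun setT (fun x => (v1 x)%:E + (v2 x)%:E)%E.
    exact: emeasurable_funD.
  have muv : measurable_fun setT (fun x => (u x)%:E + ((v1 x)%:E + (v2 x)%:E))%E.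
    exact: emeasurable_funD.
  have mabs : measurable_fun setT (fun t => (`|phi c * g n t - phi t * g n t|)%:E).
    have h : measurable_fun setT (fun t => phi c * g n t - phi t * g n t).
      by apply: measurable_funB; apply: measurable_funM.
    apply/measurable_EFinP; exact: (measurableT_comp (@normr_measurable R setT) h).
  have ptw x : `|phi c * g n x - phi x * g n x| <= u x + (v1 x + v2 x).
    rewrite -mulrBl normrM (ger0_norm (g0 x)) /u /v1 /v2.
    rewrite (_ : _ + _ = (e / 2 + 2 * M * (I1 x + I2 x)) * g n x); last ring.
    rewrite ler_wpM2r//.
    have big : `|phi c - phi x| <= 2 * M.
      apply: le_trans (ler_normB _ _) _.
      by have := phiM c; have := phiM x; lra.
    have tail : 1 <= I1 x + I2 x -> `|phi c - phi x| <= e / 2 + 2 * M * (I1 x + I2 x).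
      move=> h; have : 2 * M * 1 <= 2 * M * (I1 x + I2 x) by rewrite ler_wpM2l.
      lra.
    have [xa|ax] := leP x a.
      apply: tail; rewrite {1}/I1 indicE mem_set/= ?in_itv//=.
      by rewrite lerDl.
    have [xb|bx] := leP x b.
      have := near_c x ax xb; rewrite distrC => h; apply: le_trans h _.
      by rewrite lerDl mulr_ge0// addr_ge0.
    apply: tail; rewrite {1}/I2 indicE mem_set/= ?in_itv/= ?bx//.
    by rewrite lerDr.
  apply: (@le_trans _ _ (\int[mu]_x ((u x)%:E + ((v1 x)%:E + (v2 x)%:E)))%E).
    by apply: ge0_le_integral => //= x _; rewrite ?lee_fin// -!EFinD lee_fin.
  rewrite ge0_integralD// ge0_integralD//.
  under eq_integral do rewrite /u EFinM.
  under [X in (_ + (X + _))%E]eq_integral do rewrite /v1 EFinM.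
  under [X in (_ + (_ + X))%E]eq_integral do rewrite /v2 EFinM.
  rewrite !ge0_integralZl_EFin//.
  all: try by move=> x _; rewrite lee_fin ?mulr_ge0.
  all: try exact/measurable_EFinP.
  all: try exact: ltW.
  rewrite I1E I2E g1 mule1 -!EFinM -!EFinD lee_fin; lra.
have lim : e / 2 + 2 * M * (distfun (g n) a + (1 - distfun (g n) b)) @[n --> \oo]
    --> e / 2 + 2 * M * (0 + (1 - 1)).
  have ac : a < c by rewrite /a; lra.
  have cb : c < b by rewrite /b; lra.
  apply: cvgD; first exact: cvg_cst.
  apply: cvgM; first exact: cvg_cst.
  by apply: cvgD; [exact: glo|apply: cvgB; [exact: cvg_cst|exact: ghi]].
move/cvgrPdist_lt : lim => /(_ _ e2); apply: filterS => n.
have := bound n; rewrite subrr addr0 mulr0 addr0.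
set X := e / 2 + _; rewrite ltr_distl; lra.
Qed.

End weak_convergence.

(** * The quantile of the threshold *)
Section quantile_threshold.
Context (R : realType) d (T : measurableType d) (P : probability T R).
Variable alpha : nat -> {RV P >-> R}.
Hypothesis alpha_unif : forall j, uniform01 P (alpha j).
Hypothesis alpha_indep : mutually_independent P (fun j w => alpha j w).
Local Notation tau := (threshold alpha).

(** The quantile function takes the junk value 0 outside ]0, 1[, so the end
    points have to be excluded almost surely. *)
Lemma threshold_itv_oo : {ae P, forall w, 0 < tau w < 1}.
Proof.
have mlt t := measurable_threshold_lt alpha t.
have P1 : P [set w | tau w < 1] = 1%E.
  by rewrite (threshold_lt_prob alpha_unif alpha_indep)// ler01 lexx.
have lt1 : {ae P, forall w, tau w < 1}.
  exists (~` [set w | tau w < 1]); split=> //; first exact: measurableC.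
  by rewrite probability_setC// P1 subee.
pose A := \bigcap_n [set w | tau w < (n.+1%:R)^-1].
have mA : measurable A by apply: bigcap_measurableType => n _; exact: mlt.
have A0 : P A = 0%E.
  apply/eqP; rewrite eq_le measure_ge0 andbT; apply/lee_addgt0Pr => e e0; rewrite add0e.
  pose n := Num.truncn (e^-1).
  have ne : (n.+1%:R)^-1 <= e.
    by rewrite invf_ple ?posrE// ltW// truncnS_gt.
  apply: (@le_trans _ _ (n.+1%:R^-1)%:E); last by rewrite lee_fin.
  have n01 : 0 <= (n.+1%:R^-1 : R) <= 1.
    by rewrite invr_ge0 ler0n invf_le1// ler1n.
  rewrite -(threshold_lt_prob alpha_unif alpha_indep n01).
  by apply: le_measure; rewrite ?inE// => w /(_ n I).
have gt0 : {ae P, forall w, 0 < tau w}.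
  exists A; split=> // w /= /negP; rewrite -leNgt => w0 n _ /=.
  by apply: le_lt_trans w0 _; rewrite invr_gt0.
by apply: filterS2 gt0 lt1 => w -> ->.
Qed.

Section fixed_density.
Variable f : R -> R.
Hypothesis Df : Dplus f.
Let pf : prob_density f. Proof. by case: Df. Qed.
Local Notation Q := (quantile f).

(** F(x) < tau for x < Q(tau) and F(x) > tau for x > Q(tau), so the distribution
    functions S_n(F(x)) tend to 0 on the left of Q(tau) and to 1 on the
    right. *)
Lemma weak_limit_threshold : {ae P, forall w,
  cvg_weakly_to_dirac (density_orbit (fun j => alpha j w) f) (Q (tau w))}.
Proof.
apply: filterS2 threshold_itv_oo (threshold_separates alpha_unif alpha_indep) => w t01 sep.
have [FQ fQ] := quantileK Df t01.
have [lo hi] := Dplus_distfun_lt Df fQ; rewrite FQ in lo hi.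
have F01 x : 0 <= distfun f x <= 1 by rewrite distfun_ge0// distfun_le1.
have E n := density_orbit_distfun (fun j => alpha j w) n pf.
apply: cvg_weakly_to_dirac_distfun => [n|x xc|x cx]; first by have [] := E n.
  under eq_fun do rewrite (E _).2.
  by have [h _] := sep _ (F01 x); apply: h; exact: lo.
under eq_fun do rewrite (E _).2.
by have [_ h] := sep _ (F01 x); apply: h; exact: hi.
Qed.

Lemma quantile_ltE t x : 0 < t < 1 -> (Q t < x) = (t < distfun f x).
Proof.
move=> t01; have [FQ fQ] := quantileK Df t01.
have [_ hi] := Dplus_distfun_lt Df fQ; rewrite FQ in hi.
apply/idP/idP => [/hi//|]; apply: contraTT; rewrite -!leNgt => xQ.
by rewrite -FQ; apply: distfun_nd.
Qed.

(** Measurability is required everywhere, so the values 0 and 1 of the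
    threshold, at which the quantile is a constant, are treated apart. *)
Lemma measurable_quantile_threshold : measurable_fun setT (fun w => Q (tau w)).
Proof.
apply: (measurability _ (RGenInftyO.measurableE R)) => //.
move=> _ [_ [x ->] <-]; rewrite setTI.
have mle t : measurable [set w | t <= tau w].
  have -> : [set w | t <= tau w] = setT `&` tau @^-1` `[t, +oo[.
    by rewrite setTI; apply/seteqP; split=> w; rewrite /= in_itv/= andbT.
  by apply: measurable_threshold => //; exact: measurable_itv.
have mgt t : measurable [set w | t < tau w].
  have -> : [set w | t < tau w] = setT `&` tau @^-1` `]t, +oo[.
    by rewrite setTI; apply/seteqP; split=> w; rewrite /= in_itv/= andbT.
  by apply: measurable_threshold => //; exact: measurable_itv.
have mC (p : Prop) : measurable [set _ : T | p].
  have [h|h] := pselect p.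
    by rewrite (_ : [set _ | _] = setT)//; apply/seteqP; split.
  by rewrite (_ : [set _ | _] = set0)//; apply/seteqP; split.
have -> : (fun w => Q (tau w)) @^-1` `]-oo, x[%classic =
   ([set w | 0 < tau w] `&` [set w | tau w < 1] `&` [set w | tau w < distfun f x])
   `|` (([set w | 1 <= tau w] `&` [set _ | Q 1 < x])
   `|` ((~` [set w | 0 < tau w]) `&` [set _ | Q 0 < x])).
  apply/seteqP; split=> w /=; rewrite in_itv/=; have /andP[t0 t1] := threshold_itv alpha w.
    move=> Qx; have [w0|w0] := ltP 0 (tau w); last first.
      have w00 : tau w = 0 by apply/eqP; rewrite eq_le w0 t0.
      by right; right; rewrite w00 in Qx; split.
    have [w1|w1] := ltP (tau w) 1.
      by left; rewrite -quantile_ltE ?w0.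
    have w11 : tau w = 1 by apply/eqP; rewrite eq_le w1 t1.
    by right; left; rewrite w11 in Qx; split.
  case=> [[[w0 w1]]|[[w1 Q1]|[w0 Q0]]].
  - by rewrite -quantile_ltE ?w0.
  - by have -> : tau w = 1 by apply/eqP; rewrite eq_le w1 t1.
  - have -> // : tau w = 0.
    by apply/eqP; rewrite eq_le t0 andbT leNgt; exact/negP.
apply: measurableU; last apply: measurableU; repeat apply: measurableI => //.
- exact: measurable_threshold_lt.
- exact: measurable_threshold_lt.
- exact: measurableC.
Qed.

(** Q(tau) < x if and only if tau < F(x), which has probability F(x). *)
Lemma quantile_threshold_density : has_density P (fun w => Q (tau w)) f.
Proof.
have mQ := measurable_quantile_threshold.
split=> // B mB; have [mf f0 _] := pf.
pose XG : T -> measurableTypeR R := fun w => Q (tau w).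
have mXG : measurable_fun setT XG by exact: mQ.
pose XGp : {mfun T >-> measurableTypeR R} :=
  HB.pack XG (isMeasurableFun.Build _ _ _ _ _ mXG).
apply: (@measure_eq_rays R (distribution P XGp) (density_measure mf f0)) => //.
  move=> t; apply: (eq_trans _ (esym (density_measure_rayoE pf t))).
  have F01 : 0 <= distfun f t <= 1 by rewrite distfun_ge0// distfun_le1.
  rewrite -(threshold_lt_prob alpha_unif alpha_indep F01).
  have mpre : measurable (XG @^-1` `]-oo, t[).
    by rewrite -[X in measurable X]setTI; apply: (mXG measurableT); exact: (@measurable_itv R).
  have mlt := measurable_threshold_lt alpha (distfun f t).
  have E : {ae P, forall w, (XG @^-1` `]-oo, t[) w <-> tau w < distfun f t}.
    by apply: filterS threshold_itv_oo => w w01; rewrite /= in_itv/= /XG quantile_ltE.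
  apply/eqP; rewrite eq_le; apply/andP; split.
    by apply: (ae_le_measure mpre mlt); apply: filterS E => w [].
  by apply: (ae_le_measure mlt mpre); apply: filterS E => w [].
move=> t; rewrite (le_lt_trans (probability_le1 _ _))// ?ltry//.
Qed.
End fixed_density.
End quantile_threshold.

(** * Factorization of one step near the boundary *)
Section cosine_factor.
Variable R : realType.
Implicit Types (z : R).

(** The numbers k, s = sqrt (1 - k^2) and r = k / (1 + s) for which
    1 - k cos t = (1 + s) / 2 * |1 - r e^(i t)|^2. As z tends to 0, k tends to 1
    and s to 0. *)
Definition amplitude z : R := sin (pi * z) / (pi * z).
Definition coamplitude z : R := Num.sqrt (1 - amplitude z ^+ 2).
Definition cosine_radius z : R := amplitude z / (1 + coamplitude z).

Lemma amplitude_itv z : 0 < z < 1 -> 0 < amplitude z < 1.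
Proof.
move=> /andP[z0 z1]; have pz : 0 < pi * z by rewrite mulr_gt0// pi_gt0.
have pz1 : pi * z < pi by rewrite -[ltRHS]mulr1 ltr_pM2l// pi_gt0.
rewrite /amplitude divr_gt0// ?sin_gt0_pi ?pz//=.
by rewrite ltr_pdivrMr// mul1r; apply: sin_lt_id; rewrite pz ltW.
Qed.

Lemma coamplitude_ge0 z : 0 <= coamplitude z. Proof. exact: sqrtr_ge0. Qed.

Lemma coamplitude_sqr z : 0 < z < 1 -> coamplitude z ^+ 2 = 1 - amplitude z ^+ 2.
Proof. by move=> /amplitude_itv k01; rewrite sqr_sqrtr//; nra. Qed.

Lemma cosine_radius_itv z : 0 < z < 1 -> 0 <= cosine_radius z < 1.
Proof.
move=> z01; have k01 := amplitude_itv z01; have s0 := coamplitude_ge0 z.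
have s1 : 0 < 1 + coamplitude z by lra.
rewrite /cosine_radius divr_ge0 ?(ltW s1)//=; last lra.
by rewrite ltr_pdivrMr// mul1r; lra.
Qed.

Lemma cosine_factorE z u : 0 < z < 1 ->
  1 - amplitude z * cos (2 * pi * u) =
  expR (log_kernel (cosine_radius z) u) * ((1 + coamplitude z) / 2).
Proof.
move=> z01; have r01 := cosine_radius_itv z01.
rewrite /log_kernel lnK ?posrE ?kernel_gt0//.
have s0 := coamplitude_ge0 z; have s2 := coamplitude_sqr z01.
have s1 : 1 + coamplitude z != 0 by lra.
move: (cos _) => c; rewrite /cosine_radius; move: (amplitude z) (coamplitude z) s2 s1 s0 => k s s2 s1 s0.
have -> : 1 + (k / (1 + s)) ^+ 2 = 2 / (1 + s).
  have -> : (k / (1 + s)) ^+ 2 = (1 - s ^+ 2) / (1 + s) ^+ 2.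
    by rewrite s2 exprMn exprVn; congr (_ * _); ring.
  by field.
by field.
Qed.

Lemma amplitude_ge_cos z : 0 < z <= 1 / 2 -> cos (pi * z) <= amplitude z.
Proof.
move=> /andP[z0 z2]; have pp := @pi_gt0 R.
have pz : 0 < pi * z by rewrite mulr_gt0.
rewrite /amplitude ler_pdivlMr// mulrC; apply: sin_geM; rewrite (ltW pz)/=.
by rewrite ler_pM2l//; lra.
Qed.

Lemma coamplitude_cvg (U : nat -> R) : (forall n, 0 < U n < 1) ->
  U n @[n --> \oo] --> (0 : R) -> coamplitude (U n) @[n --> \oo] --> (0 : R).
Proof.
move=> U01 U0.
have cosU : cos (pi * U n) @[n --> \oo] --> (1 : R).
  have h : pi * U n @[n --> \oo] --> pi * (0 : R) by apply: cvgM => //; exact: cvg_cst.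
  rewrite -(@cos0 R) -(mulr0 pi); exact: (continuous_cvg _ (@continuous_cos R _) h).
have kU : amplitude (U n) @[n --> \oo] --> (1 : R).
  have c1 : (fun _ : nat => 1 : R) @ \oo --> (1 : R) by exact: cvg_cst.
  apply: (squeeze_cvgr _ cosU c1).
  move/cvgrPdist_lt : U0 => /(_ (1/2)) h.
  have h2 : 0 < 1 / 2 :> R by lra.
  move: (h h2); apply: filterS => n; rewrite sub0r normrN => Un.
  have U1 := U01 n; rewrite amplitude_ge_cos /=.
    by have := amplitude_itv U1; lra.
  by move: Un; rewrite ger0_norm; lra.
have h : 1 - amplitude (U n) ^+ 2 @[n --> \oo] --> (1 - 1 * 1 : R).
  have k2 : amplitude (U n) ^+ 2 @[n --> \oo] --> (1 * 1 : R) by apply: cvgM; exact: kU.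
  by apply: cvgB; [exact: cvg_cst|exact: k2].
rewrite mulr1 subrr in h.
rewrite -(@sqrtr0 R); exact: (continuous_cvg _ (@sqrt_continuous R _) h).
Qed.

(** ln (U n) is ln (U 0), plus the sum of the L i, which is o(n), plus the sum of
    ln ((1 + s_i) / 2), whose terms tend to - ln 2 and hence do so in mean. *)
Lemma log_decay (U L : nat -> R) : (forall n, 0 < U n < 1) ->
  (forall n, U n.+1 = U n * (expR (L n) * ((1 + coamplitude (U n)) / 2))) ->
  U n @[n --> \oo] --> (0 : R) ->
  (\sum_(0 <= i < n) L i) / n%:R @[n --> \oo] --> (0 : R) ->
  n%:R^-1 * ln (U n) @[n --> \oo] --> - ln (2 : R).
Proof.
move=> U01 UE U0 L0.
pose v i := ln ((1 + coamplitude (U i)) / 2).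
have lnU n : ln (U n) = ln (U 0%N) + (\sum_(0 <= i < n) L i + \sum_(0 <= i < n) v i).
  elim: n => [|n IH]; first by rewrite !big_geq// !addr0.
  have s0 := coamplitude_ge0 (U n).
  have p1 : 0 < (1 + coamplitude (U n)) / 2 by lra.
  rewrite UE lnM ?posrE//; last 2 first.
    by have /andP[] := U01 n.
    by rewrite mulr_gt0// expR_gt0.
  by rewrite lnM ?posrE ?expR_gt0// expRK IH !big_nat_recr//= /v; ring.
have vl : v n @[n --> \oo] --> - ln (2 : R).
  have s0 := coamplitude_cvg U01 U0.
  have h : (1 + coamplitude (U n)) / 2 @[n --> \oo] --> ((1 + 0) / 2 : R).
    by apply: cvgM; [apply: cvgD => //; exact: cvg_cst|exact: cvg_cst].
  have h2 : (0 : R) < (1 + 0) / 2 by lra.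
  have -> : - ln (2 : R) = ln ((1 + 0) / 2).
    by rewrite addr0 mul1r lnV// posrE.
  exact: (continuous_cvg _ (continuous_ln h2) h).
have cv := cesaro vl.
have cv2 : (\sum_(0 <= i < n) v i) / n%:R @[n --> \oo] --> - ln (2 : R).
  rewrite -cvg_shiftS; apply: cvg_trans cv; apply: near_eq_cvg; apply: nearW => n.
  by rewrite /arithmetic_mean /series /= mulrC.
have c0 : ln (U 0%N) * n%:R^-1 @[n --> \oo] --> (0 : R).
  have h : ln (U 0%N) * n.+1%:R^-1 @[n --> \oo] --> (ln (U 0%N) * 0 : R).
    by apply: cvgM; [exact: cvg_cst|exact: cvg_harmonic].
  by rewrite mulr0 in h; rewrite -cvg_shiftS.
have h : ln (U 0%N) * n%:R^-1 + ((\sum_(0 <= i < n) L i) / n%:R +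
    (\sum_(0 <= i < n) v i) / n%:R) @[n --> \oo] --> (0 + (0 + - ln 2) : R).
  by apply: cvgD => //; exact: cvgD.
rewrite !add0r in h; apply: cvg_trans h.
apply: near_eq_cvg; apply: nearW => n /=.
rewrite (lnU n); ring.
Qed.
End cosine_factor.

(** * The law of large numbers along the orbit *)
Section kernel_measurability.
Variable R : realType.

(** Inversion is not continuous at 0 and is written through a real power. *)
Lemma measurable_invr : measurable_fun setT (fun x : R => x^-1).
Proof.
have -> : (fun x : R => x^-1) = (fun x => (x ^+ 2) `^ (-1) * x).
  apply/funext => x; rewrite powR_inv1 ?sqr_ge0//.
  have [->|x0] := eqVneq x 0; first by rewrite mulr0 invr0.
  by field.
apply: measurable_funM => //.
apply: (@measurableT_comp _ _ _ _ _ _ (fun y : R => y `^ (-1))) => //.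
Qed.

Lemma measurable_cosine_radius : measurable_fun setT (@cosine_radius R).
Proof.
have mk : measurable_fun setT (@amplitude R).
  have mpi : measurable_fun setT (fun z : R => pi * z) by exact: measurable_funM.
  apply: measurable_funM.
    apply: continuous_measurable_fun; exact: continuous_sin_pi.
  exact: (measurableT_comp measurable_invr mpi).
have ms : measurable_fun setT (@coamplitude R).
  apply: (@measurableT_comp _ _ _ _ _ _ (@Num.sqrt R)).
    by apply: continuous_measurable_fun; exact: sqrt_continuous.
  by apply: measurable_funB => //; exact: measurable_funX.
apply: measurable_funM => //.
apply: (measurableT_comp measurable_invr).
exact: measurable_funD.
Qed.

Lemma measurable_log_kernel :
  measurable_fun setT (fun x : R * R => log_kernel x.1 x.2).
Proof.
apply: (measurableT_comp (@measurable_ln R)).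
have m1 : measurable_fun setT (fun x : R * R => x.1) by exact: measurable_fst.
have m2 : measurable_fun setT (fun x : R * R => x.2) by exact: measurable_snd.
apply: measurable_funB.
  by apply: measurable_funD => //; exact: measurable_funX.
apply: measurable_funM; first exact: measurable_funM.
apply: (measurableT_comp (f := cos)).
  by apply: continuous_measurable_fun; exact: continuous_cos.
exact: measurable_funM.
Qed.

End kernel_measurability.

Section orbit_log_law.
Context (R : realType) d (T : measurableType d) (P : probability T R).
Variable alpha : nat -> {RV P >-> R}.
Hypothesis alpha_unif : forall j, uniform01 P (alpha j).
Hypothesis alpha_indep : mutually_independent P (fun j w => alpha j w).
Local Notation mu := (@lebesgue_measure R).

Variable z : R.
Hypothesis z01 : 0 < z < 1.
Let z01' : 0 <= z <= 1. Proof. by case/andP: z01 => z0 z1; rewrite !ltW. Qed.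
Local Notation Z := (orbit_value alpha z).

(* Radius and phase of the kernel as functions of the current rank; the orbit
   and its reflection 1 - z_n need different choices. *)
Variables rr cc : R -> R.
Hypothesis mrr : measurable_fun setT rr.
Hypothesis mcc : measurable_fun setT cc.
Hypothesis rr01 : forall x, 0 < x < 1 -> 0 <= rr x < 1.
Hypothesis cc01 : forall x, 0 < x < 1 -> 0 <= cc x <= 1.

Lemma orbit_value_itv_oo n w : 0 < Z n w < 1.
Proof. exact: rank_orbit_itv_oo. Qed.

(* ln 4 bounds the kernel above, so psi is nonnegative, as the strong law
   requires. *)
Let psi (x u : R) : R := ln 4 - log_kernel (rr x) (u + cc x).
Let X n w := psi (Z n w) (alpha n w).

Let mpsi : measurable_fun setT (fun x : R * R => psi x.1 x.2).
Proof.
apply: measurable_funB => //.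
apply: (measurableT_comp (@measurable_log_kernel R)
  (g := fun x : R * R => (rr x.1, x.2 + cc x.1))).
apply: measurable_fun_pair; first exact: (measurableT_comp mrr measurable_fst).
apply: measurable_funD; first exact: measurable_snd.
exact: (measurableT_comp mcc measurable_fst).
Qed.

Let psi_ge0 x u : 0 < x < 1 -> 0 <= psi x u.
Proof. by move=> x01; rewrite subr_ge0 log_kernel_le// rr01. Qed.

Let continuous_shifted x : 0 < x < 1 ->
  continuous (fun u => log_kernel (rr x) (u + cc x)).
Proof.
move=> x01 u; apply: (@continuous_comp _ _ _ (fun u : R => u + cc x)).
  by apply: cvgD; [exact: cvg_id|exact: cvg_cst].
by apply: continuous_log_kernel; exact: rr01.
Qed.

Let psi_mean x : 0 < x < 1 ->
  (\int[mu]_(u in `[0%R, 1%R]) (psi x u)%:E = (ln 4)%:E)%E.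
Proof.
move=> x01; have r01 := rr01 x01; have cs := continuous_shifted x01.
rewrite Rintegral_EFin; last first.
  by move=> u; apply: cvgB; [exact: cvg_cst|exact: cs].
congr EFin; rewrite RintegralB//; last 2 first.
- by apply: continuous_integrable_itv; exact: cst_continuous.
- exact: (continuous_integrable_itv _ _ cs).
rewrite Rintegral01_cst (@Rintegral_periodic_shift _ (log_kernel (rr x))).
- by rewrite Rintegral_log_kernel// subr0.
- exact: continuous_log_kernel.
- exact: log_kernel_periodic.
- exact: cc01.
Qed.

Let psi_sqr x : 0 < x < 1 ->
  (\int[mu]_(u in `[0%R, 1%R]) (psi x u ^+ 2)%:E <= (3 * ln 4 ^+ 2)%:E)%E.
Proof.
move=> x01; have r01 := rr01 x01; have cs := continuous_shifted x01.
pose L u := log_kernel (rr x) (u + cc x).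
have cL2 : continuous (fun u => L u ^+ 2) by move=> u; exact: (cvgM (cs u) (cs u)).
have cL1 : continuous (fun u => 2 * ln 4 * L u).
  by move=> u; apply: cvgM; [exact: cvg_cst|exact: cs].
have cL3 : continuous (fun u => ln 4 ^+ 2 - 2 * ln 4 * L u).
  by move=> u; apply: cvgB; [exact: cvg_cst|exact: cL1].
have E u : psi x u ^+ 2 = (ln 4 ^+ 2 - 2 * ln 4 * L u) + L u ^+ 2.
  by rewrite /psi -/(L u); ring.
under eq_integral do rewrite E.
rewrite Rintegral_EFin; last first.
  by move=> u; apply: cvgD; [exact: cL3|exact: cL2].
rewrite lee_fin RintegralD//; last 2 first.
- exact: (continuous_integrable_itv _ _ cL3).
- exact: (continuous_integrable_itv _ _ cL2).
rewrite RintegralB//; last 2 first.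
- by apply: continuous_integrable_itv; exact: cst_continuous.
- exact: (continuous_integrable_itv _ _ cL1).
rewrite RintegralZl//; last exact: (continuous_integrable_itv _ _ cs).
rewrite Rintegral01_cst (@Rintegral_periodic_shift _ (log_kernel (rr x))); last 3 first.
- exact: continuous_log_kernel.
- exact: log_kernel_periodic.
- exact: cc01.
rewrite Rintegral_log_kernel// (@Rintegral_periodic_shift _ (fun u => log_kernel (rr x) u ^+ 2)); last 3 first.
- move=> u; have h := @continuous_log_kernel _ _ r01 u; exact: (cvgM h h).
- by move=> u; rewrite log_kernel_periodic.
- exact: cc01.
by have := Rintegral_log_kernel_sqr r01; lra.
Qed.

Let FX n : filtration_meas alpha n.+1 (X n).
Proof.
apply: (@filtration_meas_comp _ _ _ _ _ _ _ _ _ _ (fun w => (Z n w, alpha n w))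
  (fun x : R * R => psi x.1 x.2)); last exact: mpsi.
apply: filtration_meas_pair; last exact: filtration_meas_RV.
by apply: filtration_measS; exact: filtration_meas_orbit.
Qed.

Let S n w := \sum_(0 <= i < n) X i w.

Let FS n : filtration_meas alpha n (S n).
Proof.
elim: n => [|n IH].
  have -> : S 0 = fun=> 0 by apply/funext => w; rewrite /S big_geq.
  exact: filtration_meas_cst.
have -> : S n.+1 = (fun x : R * R => x.1 + x.2) \o (fun w => (S n w, X n w)).
  by apply/funext => w; rewrite /S big_nat_recr.
apply: filtration_meas_comp; last first.
  by apply: measurable_funD; [exact: measurable_fst|exact: measurable_snd].
by apply: filtration_meas_pair => //; exact: filtration_measS.
Qed.

Let mX n : measurable_fun setT (X n). Proof. exact: (filtration_meas_fun (@FX n)). Qed.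

Let X0 n w : 0 <= X n w. Proof. by apply: psi_ge0; exact: orbit_value_itv_oo. Qed.

Local Open Scope ereal_scope.

(* Given the past, the angle alpha n is uniform; s is a weight that depends on
   the past, and the exponent is 1 or 2. *)
Let frozen n (s : T -> R) (e : nat) : filtration_meas alpha n s ->
  (forall w, 0 <= s w)%R ->
  \int[P]_w (s w * X n w ^+ e)%:E =
  \int[P]_w ((s w)%:E * \int[mu]_(u in `[0%R, 1%R]) (psi (Z n w) u ^+ e)%:E).
Proof.
move=> Fs s0.
pose phi (x : R * R * R) := (`|x.1.1 * psi x.1.2 x.2 ^+ e|)%:E.
have mphi : measurable_fun setT phi.
  apply/measurable_EFinP; apply: measurableT_comp => //.
  apply: measurable_funM; first by apply: measurableT_comp => //; exact: measurable_fst.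
  apply: measurable_funX.
  apply: (measurableT_comp mpsi (g := fun x : R * R * R => (x.1.2, x.2))).
  apply: measurable_fun_pair; last exact: measurable_snd.
  by apply: measurableT_comp => //; exact: measurable_snd.
have phi0 x : 0 <= phi x by rewrite lee_fin.
have FW := filtration_meas_pair Fs (@filtration_meas_orbit _ _ _ _ alpha _ z01' n).
have := filtration_freezing alpha_indep alpha_unif FW mphi phi0.
have E w u : phi ((s w, Z n w), u) = (s w)%:E * (psi (Z n w) u ^+ e)%:E.
  rewrite /phi/= ger0_norm ?EFinM// mulr_ge0// exprn_ge0// psi_ge0//.
  exact: orbit_value_itv_oo.
under eq_integral do rewrite E -EFinM.
move=> ->; apply: eq_integral => w _.
under eq_integral do rewrite E.
have W01 := orbit_value_itv_oo n w.
rewrite ge0_integralZl//.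
- apply/measurable_EFinP; apply: measurable_funTS; apply: measurable_funX.
  exact: (measurableT_comp mpsi (pair1_measurable _)).
- by move=> u _; rewrite lee_fin exprn_ge0// psi_ge0.
- by rewrite lee_fin.
Qed.

Let EsX n (s : T -> R) : filtration_meas alpha n s -> (forall w, 0 <= s w)%R ->
  \int[P]_w (s w * X n w)%:E = (ln 4)%:E * \int[P]_w (s w)%:E.
Proof.
move=> Fs s0; have := @frozen n s 1%N Fs s0.
under eq_integral do rewrite expr1.
move=> ->; rewrite -ge0_integralZl//; last 3 first.
- by apply/measurable_EFinP; exact: (filtration_meas_fun Fs).
- by move=> w _; rewrite lee_fin.
- by rewrite lee_fin ln_ge0// ler1n.
apply: eq_integral => w _; rewrite muleC; congr (_ * _).
by under eq_integral do rewrite expr1; rewrite psi_mean//; exact: orbit_value_itv_oo.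
Qed.

Let EX n : \int[P]_w (X n w)%:E = (ln 4)%:E.
Proof.
have := @EsX n (fun=> 1%R) (@filtration_meas_cst _ _ _ _ _ _ _ _ _) (fun=> ler01).
under eq_integral do rewrite mul1r.
by move=> ->; rewrite integral_cst//= probability_setT !mule1.
Qed.

Let EX2 n : \int[P]_w (X n w ^+ 2)%:E <= (3 * ln 4 ^+ 2)%:E.
Proof.
have := @frozen n (fun=> 1%R) 2 (@filtration_meas_cst _ _ _ _ _ _ _ _ _) (fun=> ler01).
under eq_integral do rewrite mul1r.
move=> ->; apply: (@le_trans _ _ (\int[P]_w (3 * ln 4 ^+ 2)%:E)); last first.
  by rewrite integral_cst//= probability_setT mule1.
apply: ge0_le_integral => //.
- move=> w _; rewrite mul1e; apply: integral_ge0 => u _.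
  by rewrite lee_fin sqr_ge0.
- pose f (x : R * measurableTypeR R) := (psi x.1 x.2 ^+ 2 * \1_`[0%R, 1%R] x.2)%:E.
  have mf : measurable_fun setT f.
    apply/measurable_EFinP; apply: measurable_funM.
      by apply: measurable_funX; exact: mpsi.
    have m1 : measurable_fun setT (\1_`[0%R, 1%R] : measurableTypeR R -> R).
      by apply: measurable_indic; exact: measurable_itv.
    exact: (measurableT_comp m1 measurable_snd).
  have f0 x : 0 <= f x by rewrite lee_fin mulr_ge0// sqr_ge0.
  have := @measurable_fun_fubini_tonelli_F _ _ R (measurableTypeR R) R
    lebesgue_measure f mf f0.
  move/(fun h => measurableT_comp h (@measurable_orbit _ _ _ _ alpha _ z01' n)).
  congr (measurable_fun _ _); apply/funext => w.
  rewrite mul1e /fubini_F /= [RHS]integral_mkcond.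
  by apply: eq_integral => u _; rewrite /f /= patchE indicE; case: ifP => _;
    rewrite ?mulr1 ?mulr0.
- by move=> w _; rewrite mul1e; apply: psi_sqr; exact: orbit_value_itv_oo.
Qed.

(** Given the past, psi has mean ln 4 and second moment at most 3 (ln 4)^2. The
    conditional mean is constant, so psi is uncorrelated with the past, and
    the strong law gives averages ln 4 for psi, that is 0 for the kernel. *)
Lemma orbit_log_kernel_law : {ae P, forall w,
  ((\sum_(0 <= i < n) log_kernel (rr (Z i w)) (alpha i w + cc (Z i w))) / n%:R)%R
    @[n --> \oo] --> (0 : R)%R}.
Proof.
have ES n : \int[P]_w (S n w)%:E = (n%:R * ln 4)%:E.
  under eq_integral do rewrite /S -sumEFin.
  rewrite ge0_integral_sum//; last 2 first.
  - by move=> i; exact/measurable_EFinP.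
  - by move=> i w _; rewrite lee_fin.
  under eq_bigr do rewrite EX.
  by rewrite sumEFin sumr_const_nat subn0 mulr_natl.
have S0 n w : (0 <= S n w)%R by apply: sumr_ge0.
have := @strong_law_nonneg R d T P X (ln 4) (3 * ln 4 ^+ 2) mX X0.
have C0 : (0 <= 3 * ln 4 ^+ 2 :> R)%R by rewrite mulr_ge0 ?sqr_ge0.
move=> /(_ C0 EX); have EXX n : \int[P]_w (S n w * X n w)%:E <= (n%:R * ln 4 ^+ 2)%:E.
  by rewrite EsX// ES -EFinM lee_fin mulrCA -expr2.
move=> /(_ EXX EX2); apply: filterS => w h.
have c0 : ((fun _ : nat => ln 4) @ \oo --> (ln 4 : R))%R by exact: cvg_cst.
have h2 : (ln 4 - (\sum_(0 <= i < n) X i w) / n%:R)%R @[n --> \oo] --> (ln 4 - ln 4 : R)%R.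
  by apply: cvgB.
rewrite subrr in h2; rewrite -cvg_shiftS; rewrite -cvg_shiftS in h2.
apply: cvg_trans h2; apply: near_eq_cvg; apply: nearW => n /=.
have -> : (\sum_(0 <= i < n.+1) X i w = ln 4 * n.+1%:R -
    \sum_(0 <= i < n.+1) log_kernel (rr (Z i w)) (alpha i w + cc (Z i w)))%R.
  by rewrite /X /psi sumrB sumr_const_nat subn0 mulr_natr.
by rewrite mulrBl mulfK ?pnatr_eq0// opprB addrC subrK.
Qed.

End orbit_log_law.

(** * The exponential rate at the boundary *)
Section boundary_rate.
Variable R : realType.

Lemma rank_step_factor (a z : R) : 0 < z ->
  rank_step a z = z * (1 - amplitude z * cos (2 * pi * (a + z / 2))).
Proof.
move=> z0; rewrite /rank_step /amplitude.
have -> : 2 * pi * (a + z / 2) = 2 * pi * a + pi * z.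
  by move: (pi : R) => p; field.
have := @pi_neq0 R; move: (pi : R) => p p0; field.
by rewrite p0 gt_eqF.
Qed.

(** By reflection; the parameter - a at 1 - z gives, up to the parity and the
    period of cosine, the phase (z + 1) / 2. *)
Lemma rank_step_cofactor (a z : R) : z < 1 ->
  1 - rank_step a z =
  (1 - z) * (1 - amplitude (1 - z) * cos (2 * pi * (a + (z + 1) / 2))).
Proof.
move=> z1; rewrite rank_step1B rank_step_factor ?subr_gt0//.
congr (_ * (1 - _ * _)); rewrite -[LHS]cosN -[LHS]cosD2pi; congr cos.
by rewrite -mulr_natr; move: (pi : R) => p; field.
Qed.

Context d (T : measurableType d) (P : probability T R).
Variable alpha : nat -> {RV P >-> R}.
Hypothesis alpha_unif : forall j, uniform01 P (alpha j).
Hypothesis alpha_indep : mutually_independent P (fun j w => alpha j w).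

(** The orbit tends to 0 or to 1. In the first case the minimum is eventually
    z_n and [log_decay] applies to z_n; in the second it applies to 1 - z_n. *)
Lemma orbit_boundary_rate (z : R) : 0 < z < 1 -> {ae P, forall w,
  n%:R^-1 * ln (Num.min (orbit_value alpha z n w) (1 - orbit_value alpha z n w))
    @[n --> \oo] --> - ln (2 : R)}.
Proof.
move=> z01; have z01' : 0 <= z <= 1 by case/andP: z01 => z0 z1; rewrite !ltW.
have mhalf : measurable_fun setT (fun x : R => x / 2) by exact: measurable_funM.
have mB : measurable_fun setT (fun x : R => 1 - x) by exact: measurable_funB.
have mhalf1 : measurable_fun setT (fun x : R => (x + 1) / 2).
  by apply: measurable_funM => //; exact: measurable_funD.
have half01 (x : R) : 0 < x < 1 -> 0 <= x / 2 <= 1.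
  by move=> /andP[x0 x1]; apply/andP; split; lra.
have half101 (x : R) : 0 < x < 1 -> 0 <= (x + 1) / 2 <= 1.
  by move=> /andP[x0 x1]; apply/andP; split; lra.
have oneB (x : R) : 0 < x < 1 -> 0 < 1 - x < 1.
  by move=> /andP[x0 x1]; apply/andP; split; lra.
have lo := @orbit_log_kernel_law R d T P alpha alpha_unif alpha_indep z z01
  (@cosine_radius R) (fun x => x / 2) (@measurable_cosine_radius R) mhalf
  (@cosine_radius_itv R) half01.
have hi := @orbit_log_kernel_law R d T P alpha alpha_unif alpha_indep z z01
  (fun x => cosine_radius (1 - x)) (fun x => (x + 1) / 2)
  (measurableT_comp (@measurable_cosine_radius R) mB) mhalf1
  (fun x x01 => cosine_radius_itv (oneB x x01)) half101.
apply: filterS3 (orbit_dichotomy_ae alpha_unif alpha_indep z01') lo hi => w.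
move=> dich lo hi.
pose U n := orbit_value alpha z n w.
have U01 n : 0 < U n < 1 by exact: orbit_value_itv_oo.
case: dich => h.
- have := @log_decay R U _ U01 _ h lo.
  have rec n : U n.+1 = U n * (expR (log_kernel (cosine_radius (U n))
      (alpha n w + U n / 2)) * ((1 + coamplitude (U n)) / 2)).
    have /andP[Un0 _] := U01 n.
    by rewrite -cosine_factorE// -rank_step_factor// /U orbit_valueS.
  move=> /(_ rec); apply: cvg_trans; apply: near_eq_cvg.
  have : \forall n \near \oo, U n < 1 / 2 by apply: cvgr_lt h _ _; lra.
  by apply: filterS => n Un; rewrite min_l//; rewrite -/(U n); lra.
- have V01 n : 0 < 1 - U n < 1 by exact/oneB/U01.
  have rec n : 1 - U n.+1 = (1 - U n) * (expR (log_kernel (cosine_radius (1 - U n))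
      (alpha n w + (U n + 1) / 2)) * ((1 + coamplitude (1 - U n)) / 2)).
    have /andP[_ Un1] := U01 n.
    by rewrite -cosine_factorE// -rank_step_cofactor// /U orbit_valueS.
  have V0 : (1 - U n) @[n --> \oo] --> (0 : R).
    have : (1 - U n) @[n --> \oo] --> (1 - 1 : R).
      by apply: cvgB => //; exact: cvg_cst.
    by rewrite subrr.
  have := @log_decay R (fun n => 1 - U n) _ V01 rec V0 hi.
  apply: cvg_trans; apply: near_eq_cvg.
  have : \forall n \near \oo, 1 / 2 < U n by apply: cvgr_gt h _ _; lra.
  by apply: filterS => n Un; rewrite min_r//; rewrite -/(U n); lra.
Qed.

End boundary_rate.

Theorem theorem35 (R : realType) (d : measure_display) (T : measurableType d)
    (P : probability T R) (alpha : nat -> {RV P >-> R})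
    (alpha_unif : forall j : nat, uniform01 P (alpha j))
    (alpha_indep : mutually_independent P (fun j w => alpha j w)) :
  let a (w : T) : nat -> R := fun j => alpha j w in
  let Sn (n : nat) (w : T) : R -> R := rank_orbit (a w) n in
  [/\ (* (i) *)
      (forall z : R, 0 <= z <= 1 ->
         [/\ (exists zinf : {RV P >-> R},
                [/\ {ae P, forall w, zinf w = 0 \/ zinf w = 1},
                    {ae P, forall w, Sn n w z @[n --> \oo] --> zinf w} &
                    P [set w | zinf w = 1] = z%:E]),
             (forall n : nat,
                is_cond_var P (natural_filtration (fun j w => alpha j w) n)
                  (fun w => Sn n.+1 w z)
                  (fun w => sin (pi * Sn n w z) ^+ 2 / (2 * pi ^+ 2))) &
             (\sum_(0 <= n <oo) 'E_P[fun w => (sin (pi * Sn n w z) ^+ 2)%R]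
                = (2 * pi ^+ 2 * (z * (1 - z)))%:E)%E]),
      (* (ii) and (iii) *)
      (exists tau : {RV P >-> R},
         [/\ {ae P, forall w, forall z : R, 0 <= z <= 1 ->
                (z < tau w -> Sn n w z @[n --> \oo] --> (0 : R)) /\
                (tau w < z -> Sn n w z @[n --> \oo] --> (1 : R))},
             uniform01 P tau &
             (forall f : R -> R, Dplus f ->
                [/\ (forall (n : nat) (w : T),
                       prob_density (density_orbit (a w) f n) /\
                       forall x : R, density_orbit (a w) f n x =
                         derive1 (Sn n w) (distfun f x) * f x),
                    {ae P, forall w, cvg_weakly_to_dirac
                       (density_orbit (a w) f) (quantile f (tau w))} &
                    has_density P (fun w => quantile f (tau w)) f])]) &
      (* (iv) *)
      (forall z : R, 0 < z < 1 ->
         {ae P, forall w,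
            n%:R^-1 * ln (Num.min (Sn n w z) (1 - Sn n w z))
              @[n --> \oo] --> - ln (2 : R)})].
Proof.
move=> a Sn; split.
- move=> z z01; split.
  + have mL := measurable_orbit_limit alpha z01.
    pose zinf : {RV P >-> R} :=
      HB.pack (orbit_limit alpha z) (isMeasurableFun.Build _ _ _ _ _ mL).
    have L := orbit_limit_cvg alpha_unif alpha_indep z01.
    exists zinf; split.
    * by apply: filterS L => w [].
    * by apply: filterS L => w [].
    * exact: orbit_limit_prob.
  + exact: orbit_cond_var.
  + rewrite -(sum_sin_orbit_limit alpha_unif alpha_indep z01).
    by apply: eq_eseriesr => n _; rewrite unlock.
- exists (threshold_RV alpha); split.
  + exact: threshold_separates.
  + exact: threshold_uniform.
  + move=> f Df; have pf := Df.1; split.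
    * move=> n w; split; first by have [] := density_orbit_distfun (a w) n pf.
      exact: density_orbit_derive.
    * exact: weak_limit_threshold.
    * exact: quantile_threshold_density.
- exact: orbit_boundary_rate.
Qed.
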